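(* Let $Z$ be a well-ordered set, let $\geq_{\rm IM}$ be an invariant monomial order on $\mathfrak{S}(Z)$, and let $S\subseteq\mathrm{OLie}(Z)\subseteq\mathbf{k}\mathfrak{S}(Z)$ be monic. The following statements are equivalent. (a) $\Pi^{\rm Lie}_S$ is convergent. (b) $S$ is a Gröbner-Shirshov basis in $\mathrm{OLie}(Z)$. (c) $\Pi^{\rm ass}_S$ is convergent. (d) $S$ is a Gröbner-Shirshov basis in $\mathbf{k}\mathfrak{S}(Z)$. (All notions are taken with respect to $\geq_{\rm IM}$.)
   Context: Let $\mathbf{k}$ be a field. Bracketed words. For a set $Y$, $S(Y)$ is the free semigroup on $Y$ (nonempty words) and $\lfloor Y\rfloor$ is a disjoint copy of $Y$. Put $\mathfrak{S}(Z)_0=S(Z)$, $\mathfrak{S}(Z)_{n+1}=S(Z\sqcup\lfloor\mathfrak{S}(Z)_n\rfloor)$, $\mathfrak{S}(Z)=\bigcup_n\mathfrak{S}(Z)_n$. Elements of $Z\sqcup\lfloor\mathfrak{S}(Z)\rfloor$ are prime; every $w\in\mathfrak{S}(Z)$ is uniquely a product $w_1\cdots w_k$ of primes, and $|w|=k$ is its breadth. $\mathbf{k}\mathfrak{S}(Z)$ is the semigroup algebra with linear operator $\lfloor\ \rfloor$. $\mathfrak{S}^\star(Z)$ is the set of words in $\mathfrak{S}(Z\sqcup\{\star\})$ with exactly one $\star$; $q|_u$ is $q$ with $\star$ replaced by $u$, extended linearly in $u\in\mathbf{k}\mathfrak{S}(Z)$. Orders. A monomial order is a well order $\geq$ on $\mathfrak{S}(Z)$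 with $u>v\Rightarrow q|_u>q|_v$ for all $q\in\mathfrak{S}^\star(Z)$. It is invariant if for all primes $u_1,\dots,u_n$ and permutations $\sigma$: $u_1\cdots u_n\geq u_{\sigma(1)}\cdots u_{\sigma(n)}\iff u_1\cdots u_n\succeq_{\rm lex}u_{\sigma(1)}\cdots u_{\sigma(n)}$, where $\succeq$ is the restriction of $\geq$ to primes; in the lex-order the empty word is larger than all nonempty words, and $xu'>_{\rm lex}yv'$ if $x>y$, or $x=y$ and $u'>_{\rm lex}v'$ ($x,y$ letters). $\overline f$ is the largest word in $f\in\mathbf{k}\mathfrak{S}(Z)\setminus\{0\}$; $f$ is monic if $\overline f$ has coefficient $1$; a set is monic if all its elements are. Lyndon-Shirshov bracketed words. For a well-ordered alphabet $A$, $\mathrm{ALSW}(A)$ is the set of $w\in S(A)$ with $uv>_{\rm lex}vu$ for every decomposition $w=uv$, $u,v\in S(A)$. A binary bracketing $(w)$ of $w\in \mathrm{ALSW}(A)$ is non-associative Lyndon-Shirshov if whenever $(w)=((u)(v))$ both $(u),(v)$ are such, and if moreover $(u)=((u_1)(u_2))$ then $v\geq_{\rm lex}u_2$; each $w\in\mathrm{ALSW}(A)$ has a unique such bracketing $[w]$. Put $\mathrm{ALSBW}(Z)_0=\mathrm{ALSW}(Z)$, $\mathrm{ALSBW}(Z)_{n+1}=\mathrm{ALSW}(Z\sqcup\lfloor\mathrm{ALSBW}(Z)_n\rfloor)$ (primes ordered by $\succeq$), $\mathrm{ALSBW}(Z)=\bigcup_n\mathrm{ALSBW}(Z)_n$.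 Recursively $[z]=z$ for $z\in Z$, $[\lfloor w'\rfloor]=\lfloor[w']\rfloor$, and for $w=w_1\cdots w_k$ ($w_i$ prime, $k>1$) $[w]$ is the non-associative Lyndon-Shirshov bracketing of $[w_1]\cdots[w_k]$ on the letters $[w_i]$, ordered as the $w_i$. $\mathrm{NLSBW}(Z)=\{[w]:w\in\mathrm{ALSBW}(Z)\}$. Bracketings are read in $\mathbf{k}\mathfrak{S}(Z)$ as commutators $(a\,b)=ab-ba$. $\mathrm{OLie}(Z)$ is the smallest subspace of $\mathbf{k}\mathfrak{S}(Z)$ containing $Z$ and closed under commutator and $\lfloor\ \rfloor$; $\mathrm{NLSBW}(Z)$ is a linear basis of it. Special normal words. Let $q\in\mathfrak{S}^\star(Z)$ and $u,q|_u\in\mathrm{ALSBW}(Z)$. There are $q'\in\mathfrak{S}^\star(Z)$ and $c\in\mathfrak{S}(Z)\cup\{\mathbf 1\}$ ($\mathbf 1$ the empty word) such that $q|_u=q'|_{uc}$, the given occurrence of $u$ being the initial segment of $uc$, $uc\in\mathrm{ALSBW}(Z)$, and $[uc]$ occurs as a bracketed subword of $[q|_u]$ at the position of $\star$ in $q'$. Write $c=c_1\cdots c_m$ with $c_i\in\mathrm{ALSBW}(Z)$, $c_1\preceq_{\rm lex}\cdots\preceq_{\rm lex}c_m$. Then $[q|_u]_u$ is obtained from $[q|_u]$ by replacing this subword $[uc]$ by $[\cdots[[[u][c_1]][c_2]]\cdots[c_m]]$. For $f\in\mathrm{OLie}(Z)$ monic with $q|_{\overline f}\in\mathrm{ALSBW}(Z)$,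 the special normal $f$-word $[q|_f]_{\overline f}$ is obtained from $[q|_{\overline f}]_{\overline f}$ by replacing that $[\overline f]$ by $f$. Rewriting. A term-rewriting system on a vector space $V$ with basis $W$ is a set $\Pi\subseteq W\times V$ of rules $t\to v$. If $t\in W$ has coefficient $\alpha\neq0$ in $f$, then $f\to_\Pi f-\alpha t+\alpha v$ is a one-step rewriting; $\overset{*}{\to}_\Pi$ is the reflexive-transitive closure. $\Pi$ is terminating if there is no infinite chain of one-step rewritings, confluent if $f\overset{*}{\to}_\Pi g_1$, $f\overset{*}{\to}_\Pi g_2$ imply that $g_1,g_2$ both rewrite to some common $h$, and convergent if both. For $s\in S$ and $q|_{\overline s}\in\mathrm{ALSBW}(Z)$ write $[q|_s]_{\overline s}=[q|_{\overline s}]-R([q|_s]_{\overline s})$, where $R([q|_s]_{\overline s})$ does not involve the basis element $[q|_{\overline s}]$. - $\Pi^{\rm Lie}_S=\{[q|_{\overline s}]\to R([q|_s]_{\overline s}) : s\in S, q\in\mathfrak{S}^\star(Z), q|_{\overline s}\in\mathrm{ALSBW}(Z)\}$, on $V=\mathrm{OLie}(Z)$ with $W=\mathrm{NLSBW}(Z)$. - $\Pi^{\rm ass}_S=\{q|_{\overline s}\to q|_{R(s)} : s=\overline s-R(s)\in S, q\in\mathfrak{S}^\star(Z)\}$, on $V=\mathbf{k}\mathfrak{S}(Z)$ with $W=\mathfrak{S}(Z)$. Gröbner-Shirshov bases. Consider monic $f,g$ and a word $w$ such that either (intersection) $w=\overline f u=v\overline g$ with $u,v\in\mathfrak{S}(Z)$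 and $\max\{|\overline f|,|\overline g|\}<|w|<|\overline f|+|\overline g|$, or (including) $w=\overline f=q|_{\overline g}$ with $q\in\mathfrak{S}^\star(Z)$. - In $\mathrm{OLie}(Z)$: the composition $\langle f,g\rangle_w$ is $[fu]_{\overline f}-[vg]_{\overline g}$, respectively $f-[q|_g]_{\overline g}$; an element is trivial modulo $(S,w)$ if it is a finite sum $\sum_i\alpha_i[q_i|_{s_i}]_{\overline{s_i}}$ of multiples of special normal words with $s_i\in S$, $w>_{\rm IM}q_i|_{\overline{s_i}}$. $S$ is a Gröbner-Shirshov basis in $\mathrm{OLie}(Z)$ if all compositions $\langle f,g\rangle_w$, $f,g\in S$, are trivial modulo $(S,w)$. - In $\mathbf{k}\mathfrak{S}(Z)$: the composition $(f,g)_w$ is $fu-vg$, respectively $f-q|_g$; an element is trivial modulo $(S,w)$ if it is a finite sum $\sum_i\alpha_iq_i|_{s_i}$ with $\alpha_i\in\mathbf k$, $q_i\in\mathfrak{S}^\star(Z)$, $s_i\in S$, $w>_{\rm IM}q_i|_{\overline{s_i}}$. $S$ is a Gröbner-Shirshov basis in $\mathbf{k}\mathfrak{S}(Z)$ if all compositions $(f,g)_w$, $f,g\in S$, are trivial modulo $(S,w)$. *)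

(* Defs.v *)
From HB Require Import structures.
From mathcomp Require Import all_boot all_order all_algebra.
From mathcomp Require Import finmap.
From mathcomp Require Import wochoice.
From mathcomp Require Import monalg.
From Stdlib Require Import Relation_Operators ClassicalEpsilon.

Set Implicit Arguments.
Unset Strict Implicit.
Unset Printing Implicit Defensive.

Import GRing.Theory.

(* The free operated semigroup S(X): [word X] is the type of (nonempty)
   bracketed words on X, [letter X] the type of prime ones. *)
Inductive word (X : Type) : Type :=
  | Last of letter X
  | Cons of letter X & word X
with letter (X : Type) : Type :=
  | Gen of X
  | Brk of word X.

Arguments Last {X}. Arguments Cons {X}. Arguments Gen {X}. Arguments Brk {X}.

Scheme word_letter_rect := Induction for word Sort Type
  with letter_word_rect := Induction for letter Sort Type.

Fixpoint wcat (X : Type) (u v : word X) : word X :=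
  match u with
  | Last p => Cons p v
  | Cons p u' => Cons p (wcat u' v)
  end.

Fixpoint letters (X : Type) (w : word X) : seq (letter X) :=
  match w with
  | Last p => [:: p]
  | Cons p w' => p :: letters w'
  end.

Definition breadth (X : Type) (w : word X) : nat := size (letters w).

Definition gen (X : Type) (x : X) : word X := Last (Gen x).
Definition brk (X : Type) (w : word X) : word X := Last (Brk w).

(* The morphism of operated semigroups extending f : X -> word Y. *)
Fixpoint wsubst (X Y : Type) (f : X -> word Y) (w : word X) : word Y :=
  match w with
  | Last p => lsubst f p
  | Cons p w' => wcat (lsubst f p) (wsubst f w')
  end
with lsubst (X Y : Type) (f : X -> word Y) (p : letter X) : word Y :=
  match p with
  | Gen x => f x
  | Brk w => brk (wsubst f w)
  end.

Section ChoiceInstances.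
Context (X : Type).

Fixpoint enc_word (w : word X) : GenTree.tree X :=
  match w with
  | Last p => GenTree.Node 0 [:: enc_letter p]
  | Cons p w' => GenTree.Node 1 [:: enc_letter p; enc_word w']
  end
with enc_letter (p : letter X) : GenTree.tree X :=
  match p with
  | Gen x => GenTree.Leaf x
  | Brk w => GenTree.Node 0 [:: enc_word w]
  end.

Fixpoint dec_word (t : GenTree.tree X) : option (word X) :=
  match t with
  | GenTree.Node 0 [:: a] => omap Last (dec_letter a)
  | GenTree.Node 1 [:: a; b] =>
      obind (fun p => omap (Cons p) (dec_word b)) (dec_letter a)
  | _ => None
  end
with dec_letter (t : GenTree.tree X) : option (letter X) :=
  match t with
  | GenTree.Leaf x => Some (Gen x)
  | GenTree.Node 0 [:: a] => omap Brk (dec_word a)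
  | _ => None
  end.

Lemma enc_wordK : pcancel enc_word dec_word.
Proof.
move=> w; apply: (@word_letter_rect X
  (fun w => dec_word (enc_word w) = Some w)
  (fun p => dec_letter (enc_letter p) = Some p)) w => //=.
- by move=> p ->.
- by move=> p -> w ->.
- by move=> w ->.
Qed.

Lemma enc_letterK : pcancel enc_letter dec_letter.
Proof. by case=> //= w; rewrite enc_wordK. Qed.

End ChoiceInstances.

HB.instance Definition _ (X : choiceType) :=
  Choice.copy (word X) (pcan_type (@enc_wordK X)).
HB.instance Definition _ (X : choiceType) :=
  Choice.copy (letter X) (pcan_type (@enc_letterK X)).

(* Words over X with a hole: the letter [None : option X] is the star. *)
Definition star (X : Type) : word (option X) := gen None.
Arguments star {X}.

Definition wlift (X : Type) (w : word X) : word (option X) :=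
  wsubst (fun x => gen (Some x)) w.

Fixpoint nstars (X : Type) (w : word (option X)) : nat :=
  match w with
  | Last p => nstars_letter p
  | Cons p w' => nstars_letter p + nstars w'
  end
with nstars_letter (X : Type) (p : letter (option X)) : nat :=
  match p with
  | Gen None => 1
  | Gen (Some _) => 0
  | Brk w => nstars w
  end.

Definition starred (X : Type) (q : word (option X)) : bool := nstars q == 1.

(* q|_u *)
Definition plug (X : Type) (q : word (option X)) (u : word X) : word X :=
  wsubst (fun o => if o is Some x then gen x else u) q.

(* q|_r where r itself has a hole *)
Definition plug_star (X : Type) (q r : word (option X)) : word (option X) :=
  wsubst (fun o => if o is Some x then gen (Some x) else r) q.

(* Bracketings: the free operated magma. *)
Inductive nterm (X : Type) : Type :=
  | NGen of X
  | NBrk of nterm X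
  | NBin of nterm X & nterm X.

Arguments NGen {X}. Arguments NBrk {X}. Arguments NBin {X}.

Fixpoint erase (X : Type) (t : nterm X) : word X :=
  match t with
  | NGen x => gen x
  | NBrk t' => brk (erase t')
  | NBin a b => wcat (erase a) (erase b)
  end.

Fixpoint nsubst (X Y : Type) (f : X -> nterm Y) (t : nterm X) : nterm Y :=
  match t with
  | NGen x => f x
  | NBrk t' => NBrk (nsubst f t')
  | NBin a b => NBin (nsubst f a) (nsubst f b)
  end.

Definition nlift (X : Type) (t : nterm X) : nterm (option X) :=
  nsubst (fun x => NGen (Some x)) t.

Definition nplug (X : Type) (t : nterm (option X)) (a : nterm X) : nterm X :=
  nsubst (fun o => if o is Some x then NGen x else a) t.

Definition nplug_star (X : Type) (t a : nterm (option X)) : nterm (option X) :=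
  nsubst (fun o => if o is Some x then NGen (Some x) else a) t.

Lemma nterm_inhabited (X : Type) (w : word X) : inhabited (nterm X).
Proof.
by apply: (@word_letter_rect X (fun _ => inhabited (nterm X))
  (fun _ => inhabited (nterm X))) w => // x; exists; apply: NGen x.
Qed.

Section Orders.
Context (Z : choiceType) (le : rel (word Z)).
Implicit Types (u v w : word Z).

Definition wlt u v : bool := (u != v) && le u v.

Definition monomial_order : Prop :=
  well_order le /\
  forall (q : word (option Z)) u v,
    starred q -> wlt v u -> wlt (plug q v) (plug q u).

(* Lexicographic order; the empty sequence is the largest one. *)
Fixpoint lexgt (s t : seq (letter Z)) : bool :=
  match s, t with
  | [::], [::] => false
  | [::], _ :: _ => true
  | _ :: _, [::] => false
  | x :: s', y :: t' =>
      wlt (Last y) (Last x) || (x == y) && lexgt s' t'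
  end.

Definition lexge (s t : seq (letter Z)) : bool := (s == t) || lexgt s t.

Definition wlexgt u v : bool := lexgt (letters u) (letters v).
Definition wlexge u v : bool := lexge (letters u) (letters v).

Definition invariant_order : Prop :=
  forall u v, perm_eq (letters u) (letters v) -> le v u = wlexge u v.

Definition alsw w : Prop :=
  forall u v, w = wcat u v -> wlexgt (wcat u v) (wcat v u).

Fixpoint alsbw_n (n : nat) w : Prop :=
  alsw w /\
  forall w', Brk w' \in letters w ->
    match n with
    | 0 => False
    | m.+1 => alsbw_n m w'
    end.

Definition alsbw w : Prop := exists n, alsbw_n n w.

(* The letters of a bracketing are its subterms [NGen z] and [NBrk t]; they are
   compared through the letters they erase to. *)
Fixpoint nls (t : nterm Z) : Prop :=
  match t with
  | NGen _ => True
  | NBrk t' => nls t'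
  | NBin a b =>
      [/\ alsw (erase t), nls a, nls b &
          if a is NBin _ a2 then wlexge (erase b) (erase a2) else True]
  end.

(* The Lyndon-Shirshov bracketing [w] of w, meaningful for [alsbw w], in which
   case exactly one t satisfies the predicate. *)
Definition lsb w : nterm Z :=
  epsilon (nterm_inhabited w) (fun t => erase t = w /\ nls t).

(* M is [q|_u]_u with the occurrence of [u] replaced by a hole.  Here q' is
   [erase T], and c = c_1 ... c_m is given by the (possibly empty) sequence cs.
   The first equation says q = q'|_{star c}, that is, q|_u = q'|_{uc} with the
   occurrence of u marked by q being the initial segment of uc; the third one
   that [uc] is the subterm of [q|_u] at the position of the star in q'. *)
Definition special_bracketing (q : word (option Z)) u
    (M : nterm (option Z)) : Prop :=
  exists (T : nterm (option Z)) (cs : seq (word Z)),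
    [/\ q = plug_star (erase T) (foldl (@wcat _) star (map (@wlift Z) cs)),
        alsbw (foldl (@wcat _) u cs),
        lsb (plug q u) = nplug T (lsb (foldl (@wcat _) u cs)),
        (forall c, c \in cs -> alsbw c) /\
          sorted (fun c d => wlexge d c) cs &
        M = nplug_star T
              (foldl (fun a c => NBin a (nlift (lsb c))) (NGen None) cs)].

(* Although T and cs above are not unique, M is, for [starred q], [alsbw u] and
   [alsbw (plug q u)]. *)
Definition special q u : nterm (option Z) :=
  epsilon (inhabits (NGen None)) (special_bracketing q u).

End Orders.

Local Open Scope ring_scope.

Section Algebra.
Context (k : fieldType) (Z : choiceType).
(* The underlying space of the semigroup algebra of [word Z]. *)
Local Notation A := {malg k[word Z]}.
Implicit Types (f g : A).

Definition linext (E : lmodType k) (F : word Z -> E) f : E :=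
  \sum_(u <- msupp f) f@_u *: F u.

Definition amul f g : A :=
  linext (fun u => linext (fun v => << wcat u v >> : A) g) f.
Definition abrk f : A := linext (fun u => << brk u >> : A) f.
Definition acomm f g : A := amul f g - amul g f.

(* q|_f *)
Definition aplug (q : word (option Z)) f : A :=
  linext (fun u => << plug q u >> : A) f.

Fixpoint neval (X : Type) (e : X -> A) (t : nterm X) : A :=
  match t with
  | NGen x => e x
  | NBrk t' => abrk (neval e t')
  | NBin a b => acomm (neval e a) (neval e b)
  end.

Definition ngen (z : Z) : A := << gen z >>.

Inductive OLie : A -> Prop :=
  | OLie_gen z : OLie (ngen z)
  | OLie_zero : OLie 0
  | OLie_add f g : OLie f -> OLie g -> OLie (f + g)
  | OLie_scale (a : k) f : OLie f -> OLie (a *: f)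
  | OLie_comm f g : OLie f -> OLie g -> OLie (acomm f g)
  | OLie_brk f : OLie f -> OLie (abrk f).

Context (le : rel (word Z)).

Definition is_lead f (w : word Z) : Prop :=
  w \in msupp f /\ (forall u, u \in msupp f -> le u w).

Definition is_monic f : Prop := exists2 w, is_lead f w & f@_w = 1.

Definition lsbw (w : word Z) : A := neval ngen (lsb le w).

Definition NLSBW (t : A) : Prop := exists2 w, alsbw le w & t = lsbw w.

(* The special normal word [q|_f]_w, to be used with w the leading word of f. *)
Definition snw (q : word (option Z)) f (w : word Z) : A :=
  neval (fun o => if o is Some z then ngen z else f) (special le q w).

End Algebra.

Section Rewriting.
Context (k : fieldType) (E : lmodType k).

Definition lincomb (P : E -> Prop) (h : E) : Prop :=
  exists l : seq (k * E),
    (forall x, x \in l -> P x.2) /\ h = \sum_(x <- l) x.1 *: x.2.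

(* V is a subspace of E with basis W, and Pi t v stands for the rule t -> v. *)
Context (V W : E -> Prop) (Pi : E -> E -> Prop).

(* The coefficient of f on the basis element t is a. *)
Definition has_coef (t : E) (a : k) (f : E) : Prop :=
  exists2 g, lincomb (fun x => W x /\ x <> t) g & f = a *: t + g.

Definition rw_step (f g : E) : Prop :=
  V f /\ exists (t v : E) (a : k),
    [/\ W t, Pi t v, a != 0, has_coef t a f & g = f - a *: t + a *: v].

Definition rw_star : E -> E -> Prop := clos_refl_trans E rw_step.

Definition terminating : Prop :=
  ~ exists F : nat -> E, forall n, rw_step (F n) (F n.+1).

Definition confluent : Prop :=
  forall f g1 g2, V f -> rw_star f g1 -> rw_star f g2 ->
    exists h, rw_star g1 h /\ rw_star g2 h.

Definition convergent : Prop := terminating /\ confluent.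

End Rewriting.

Section Main.
Context (k : fieldType) (Z : choiceType) (le : rel (word Z)).
Local Notation A := {malg k[word Z]}.
Context (S : A -> Prop).

(* The right-hand side is R([q|_s]_w) = [q|_w] - [q|_s]_w. *)
Definition Pi_Lie (t v : A) : Prop :=
  exists s q w,
    [/\ S s, is_lead le s w, starred q, alsbw le (plug q w) &
        t = lsbw k le (plug q w) /\ v = lsbw k le (plug q w) - snw le q s w].

Definition Pi_ass (t v : A) : Prop :=
  exists s q w,
    [/\ S s, is_lead le s w, starred q &
        t = << plug q w >> /\ v = aplug q (<< w >> - s)].

Definition convergent_Lie : Prop :=
  convergent (@OLie k Z) (NLSBW (k := k) le) Pi_Lie.

Definition convergent_ass : Prop :=
  convergent (fun _ : A => True) (fun t : A => exists w, t = << w >>) Pi_ass.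

Definition trivial_Lie (w : word Z) (h : A) : Prop :=
  lincomb (fun x => exists s q v,
    [/\ S s, is_lead le s v, starred q, alsbw le (plug q v) &
        wlt le (plug q v) w /\ x = snw le q s v]) h.

Definition trivial_ass (w : word Z) (h : A) : Prop :=
  lincomb (fun x => exists s q v,
    [/\ S s, is_lead le s v, starred q &
        wlt le (plug q v) w /\ x = aplug q s]) h.

Definition intersection_at (fb gb w u v : word Z) : Prop :=
  [/\ w = wcat fb u, w = wcat v gb &
      (maxn (breadth fb) (breadth gb) < breadth w
         < breadth fb + breadth gb)%N].

Definition including_at (fb gb w : word Z) (q : word (option Z)) : Prop :=
  [/\ starred q, w = fb & w = plug q gb].

Definition GSB_Lie : Prop :=
  forall f g fb gb w, S f -> S g -> is_lead le f fb -> is_lead le g gb ->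
    (forall u v, intersection_at fb gb w u v ->
       trivial_Lie w (snw le (wcat star (wlift u)) f fb
                        - snw le (wcat (wlift v) star) g gb)) /\
    (forall q, including_at fb gb w q ->
       trivial_Lie w (f - snw le q g gb)).

Definition GSB_ass : Prop :=
  forall f g fb gb w, S f -> S g -> is_lead le f fb -> is_lead le g gb ->
    (forall u v, intersection_at fb gb w u v ->
       trivial_ass w (amul f << u >> - amul << v >> g)) /\
    (forall q, including_at fb gb w q ->
       trivial_ass w (f - aplug q g)).

End Main.

(* Main.v *)
(* Read from left to right, [lexgt] is the usual strict lexicographic order (empty
   word smallest) for the reversed order on letters, so ALSW are ordinary Lyndon
   words.  Since the order is invariant, u v > v u whenever u v is ALSW, so in a
   Lyndon-Shirshov bracketing every commutator (a b) contributes the leading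
   product ab and smaller terms.  Hence [w] has leading word w, and a special
   normal s-word is [q|_s] plus a combination of [q_i|_s] with smaller leading
   words; as leading words of Lie elements are ALSBW (NLSBW spans OLie), every
   composition in OLie is the associative one up to smaller terms, which gives
   (b) -> (d).  By the composition-diamond argument, (d) makes the leading word of
   every nonzero element of the ideal of S reducible.  That property yields
   confluence of both rewriting systems, since the difference of two normal forms
   of an element lies in the ideal; both terminate because rules strictly decrease
   leading words.  Conversely, in a convergent system every element of the span of
   the rules rewrites to 0, and such a rewriting of a composition exhibits it as
   trivial. *)
Require Import Defs.
From mathcomp Require Import all_boot all_algebra.
From mathcomp Require Import finmap wochoice monalg.
From mathcomp Require Import boolp.
From Stdlib Require Import ClassicalEpsilon Relation_Operators.

Set Implicit Arguments.
Unset Strict Implicit.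
Unset Printing Implicit Defensive.

Import GRing.Theory.

(** Both rewriting systems are instances of one abstract system: a basis $b_w$ indexed by words,
    with $b_w$ monic of leading word $w$, and rules at $b_p$ that subtract multiples of some monic
    $r$ of leading word $p$. Triangularity makes leading words agree in coordinates and in
    $k\mathfrak S(Z)$, so independence of the basis, termination and the confluence criterion are
    proved once. A rule may act below the leading word, hence termination takes a nested induction,
    on the leading word and on the tail. The composition-diamond argument runs only on the
    associative side. The span of special normal words lies in the associative ideal, so the leading
    word of each of its nonzero elements is some $q|_{\bar s}$; as the leading word of a Lie element
    it is ALSBW, and therefore the word of a Lie rule. Special normal words enter through one
    property: with the hole filled, every commutator in the bracketing multiplies out to an ALSW.
    The price is Shirshov's lemma that such a bracketing exists at each occurrence. *)

(** * Lyndon words over an ordered alphabet *)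

Section Lyndon.
Context (L : eqType) (lt : rel L).
Hypothesis lt_irr : irreflexive lt.
Hypothesis lt_trans : transitive lt.
Hypothesis lt_total : forall x y, [|| lt x y, x == y | lt y x].
Implicit Types (s t u v x y z : seq L).

(** With [lt] the reversed order on primes this is [lexgt]: the order of the definitions upside
    down, so that the empty word, greatest there, is least here. *)
Fixpoint lexs s t : bool :=
  match s, t with
  | _, [::] => false
  | [::], _ :: _ => true
  | a :: s', b :: t' => lt a b || (a == b) && lexs s' t'
  end.

Definition lexse s t := (s == t) || lexs s t.

Lemma lexs_irr : irreflexive lexs.
Proof. by elim=> //= a s ->; rewrite lt_irr eqxx. Qed.

Lemma lexs_trans : transitive lexs.
Proof.
elim=> [|b t IH] [|a s] [|c u] //= /orP[ab|/andP[/eqP-> st]].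
  by case/orP=> [bc|/andP[/eqP<- _]]; [rewrite (lt_trans ab bc)|rewrite ab].
by case/orP=> [->//|/andP[/eqP-> tu]]; rewrite eqxx (IH _ _ st tu) orbT.
Qed.

Lemma lexs_total s t : [|| lexs s t, s == t | lexs t s].
Proof.
elim: s t => [|a s IH] [|b t] //=; rewrite eqseq_cons.
have /or3P[->//|/eqP->|->] := lt_total a b; last by rewrite !orbT.
by rewrite lt_irr eqxx /= IH.
Qed.

Lemma lexseNgt s t : lexse s t = ~~ lexs t s.
Proof.
rewrite /lexse; have := lexs_total s t; case: eqVneq => [->|_] /=.
  by rewrite lexs_irr.
case st: (lexs s t) => /=; last by move=> ->.
by case ts: (lexs t s) => //; have := lexs_trans st ts; rewrite lexs_irr.
Qed.

Lemma lexse_refl s : lexse s s. Proof. by rewrite /lexse eqxx. Qed.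

Lemma lexs_le_trans s t u : lexs s t -> lexse t u -> lexs s u.
Proof. by move=> st /orP[/eqP<-//|]; apply: lexs_trans. Qed.

Lemma lexse_lt_trans s t u : lexse s t -> lexs t u -> lexs s u.
Proof. by move=> /orP[/eqP->//|]; apply: lexs_trans. Qed.

Lemma lexse_trans s t u : lexse s t -> lexse t u -> lexse s u.
Proof.
by move=> /orP[/eqP->//|st] tu; rewrite /lexse (lexs_le_trans st tu) orbT.
Qed.

Lemma lexsW s t : lexs s t -> lexse s t.
Proof. by rewrite /lexse => ->; rewrite orbT. Qed.

Lemma lexs_cat2l u s t : lexs (u ++ s) (u ++ t) = lexs s t.
Proof. by elim: u => //= a u ->; rewrite lt_irr eqxx. Qed.

Lemma lexs_catr s t : t != [::] -> lexs s (s ++ t).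
Proof. by move=> nt; rewrite -{1}[s]cats0 lexs_cat2l; case: t nt. Qed.

Lemma lexse_catr s t : lexse s (s ++ t).
Proof.
by case: t => [|a t]; rewrite ?cats0 ?lexse_refl // lexsW // lexs_catr.
Qed.

(** Only in the second case, a difference at some letter, does the comparison survive arbitrary
    extensions on the right. *)
Variant lexs_spec s t : Prop :=
  | LexPrefix v of v != [::] & t = s ++ v
  | LexDiff of forall x y, lexs (s ++ x) (t ++ y).

Lemma lexsP s t : lexs s t -> lexs_spec s t.
Proof.
elim: s t => [|a s IH] [|b t] //=; first by move=> _; apply: LexPrefix (b :: t) _ _.
case/orP=> [ab|/andP[/eqP<- /IH[v nv ->|H]]].
- by right=> x y; rewrite /= ab.
- by left with v.
- by right=> x y; rewrite /= eqxx H orbT.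
Qed.

(** As [s] is not shorter than [t], it is no proper prefix of it, so the two differ at a letter. *)
Lemma lexs_cat s t x y :
  lexs s t -> size t <= size s -> lexs (s ++ x) (t ++ y).
Proof.
case/lexsP=> [v nv ->|//]; rewrite size_cat -{2}[size s]addn0 leq_add2l.
by case: v nv.
Qed.

(** [alsw] speaks of rotations; the lemmas on products and factorizations use the comparison with
    proper suffixes, and [lyndonP] links the two. *)
Definition lyndon s :=
  s != [::] /\
  forall x y, x != [::] -> y != [::] -> s = x ++ y -> lexs s y.

Lemma lyndonP s :
  lyndon s <->
  s != [::] /\ forall x y, x != [::] -> y != [::] -> s = x ++ y ->
               lexs (x ++ y) (y ++ x).
Proof.
split=> -[ns H]; split=> // x y nx ny def_s; last rewrite def_s.
  rewrite -[x ++ y]cats0; apply: lexs_cat; rewrite -def_s; first exact: H def_s.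
  by rewrite def_s size_cat leq_addl.
have rot := H _ _ nx ny def_s.
have /or3P[//|/eqP/(congr1 size)|] := lexs_total (x ++ y) y.
  by rewrite size_cat -[RHS]add0n => /addIn/eqP; rewrite size_eq0 (negPf nx).
(* If [y] is a proper prefix, then $xy = yz$ with $|z| = |x|$; the rotation condition gives $z < x$,
   hence $yz < zy < xy = yz$. *)
case/lexsP=> [z nz def_z|/(_ x [::])]; last first.
  by rewrite cats0 => /(lexs_trans rot); rewrite lexs_irr.
have sz: size z = size x.
  by move/(congr1 size): def_z; rewrite !size_cat addnC => /addnI.
have zx: lexs z x by rewrite -(lexs_cat2l y) -def_z.
have := H _ _ ny nz; rewrite def_s -def_z => /(_ erefl) /lexs_trans.
by move/(_ _ (lexs_cat y y zx _)); rewrite sz lexs_irr => /(_ (leqnn _)).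
Qed.

Lemma lyndon1 a : lyndon [:: a].
Proof. by split=> // -[|b [|c x]] []. Qed.

(** If $s = xv$, then $s < v$ because [s] is Lyndon, and prepending [x] gives $xs < xv = s$.
    Otherwise [x] and [s] differ at a letter. *)
Lemma lyndon_prefix_lt s x : lyndon s -> x != [::] -> lexs x s -> lexs (x ++ s) s.
Proof.
move=> [ns ls] nx; case/lexsP=> [v nv def_s|/(_ s [::])]; last by rewrite cats0.
by rewrite {2}def_s lexs_cat2l; apply: ls def_s.
Qed.

(** A suffix that starts inside [s] is handled by [s] being Lyndon; a suffix of [t] is at least [t],
    and $st < t$ by [lyndon_prefix_lt]. *)
Lemma lyndon_cat s t : lyndon s -> lyndon t -> lexs s t -> lyndon (s ++ t).
Proof.
move=> ls lt_t st; have [ns Hs] := ls; have [nt Ht] := lt_t.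
have stt: lexs (s ++ t) t by apply: lyndon_prefix_lt.
split=> [|x y nx ny]; first by case: (s) ns.
move/esym/eqP; have [le|/ltnW le] := leqP (size s) (size x).
  rewrite -[x](cat_take_drop (size s)) -catA eqseq_cat ?size_takel //.
  case/andP=> _ /eqP /esym def_t; apply: lexs_le_trans stt _.
  case: (drop _ _) def_t => [->|a z def_t]; first exact: lexse_refl.
  exact/lexsW/(Ht (a :: z)).
rewrite -{1}[s](cat_take_drop (size x)) -catA eqseq_cat ?size_takel //.
case/andP=> /eqP xs /eqP ->.
case dr: (drop (size x) s) => [|a z] //.
rewrite -dr; apply: lexs_cat; last by rewrite size_drop leq_subr.
by apply: (Hs x); rewrite ?dr // {1}xs -dr cat_take_drop.
Qed.

(** Made for the word of an intersection composition. From $xy < y$ follows $xyz < yz$, which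
    settles the suffixes of $yz$; those that start inside [x] are settled by [x ++ y]. *)
Lemma lyndon_overlap x y z :
  lyndon (x ++ y) -> lyndon (y ++ z) -> x != [::] -> y != [::] ->
  lyndon (x ++ y ++ z).
Proof.
move=> [_ Hxy] [_ Hyz] nx ny.
have key: lexs (x ++ y ++ z) (y ++ z).
  rewrite catA; apply: lexs_cat; first exact: Hxy erefl.
  by rewrite size_cat leq_addl.
split=> [|a b na nb]; first by case: (x) nx.
move/esym/eqP; have [le|/ltnW le] := leqP (size x) (size a).
  rewrite -[a](cat_take_drop (size x)) -catA eqseq_cat ?size_takel //.
  case/andP=> _ /eqP /esym def_b; apply: lexs_le_trans key _.
  case: (drop _ _) def_b => [->|c w def_b]; first exact: lexse_refl.
  exact/lexsW/(Hyz (c :: w)).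
rewrite -{1}[x](cat_take_drop (size a)) -catA eqseq_cat ?size_takel //.
case/andP=> /eqP xs /eqP ->; rewrite !catA; apply: lexs_cat; last first.
  by rewrite !size_cat size_drop leq_add2r leq_subr.
apply: (Hxy a) => //; first by rewrite -size_eq0 size_cat addn_eq0 !size_eq0 (negPf ny) andbF.
by rewrite {1}xs catA cat_take_drop.
Qed.

(** The least suffix is Lyndon. Taken over the proper suffixes it is the right factor of the
    standard factorization, taken over all suffixes it is the last Lyndon factor. *)
Lemma min_suffix s : s != [::] ->
  exists x c, [/\ s = x ++ c, c != [::] &
    forall x' c', s = x' ++ c' -> c' != [::] -> lexse c c'].
Proof.
elim: s => // a s IH _; case: (s =P [::]) => [->|/eqP/IH [x [c [def_s nc minc]]]].
  exists [::], [:: a]; split=> // -[|b [|? x]] c' //=; first by move<-; rewrite lexse_refl.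
  by case=> _ <-.
have /orP[le|le]: lexse c (a :: s) || lexse (a :: s) c.
  by rewrite /lexse; have /or3P[->|->|->] := lexs_total c (a :: s); rewrite ?orbT.
- exists (a :: x), c; split=> //=; first by rewrite def_s.
  by move=> [|b x'] c' /=; [move<-|case=> _ /minc; apply].
- exists [::], (a :: s); split=> // -[|b x'] c' /=; first by move<-; rewrite lexse_refl.
  by case=> _ e nc'; apply: lexse_trans le (minc _ _ e nc').
Qed.

Lemma lyndon_min c :
  c != [::] -> (forall y d, y != [::] -> d != [::] -> c = y ++ d -> lexse c d) ->
  lyndon c.
Proof.
move=> nc H; split=> // y d ny nd def_c.
have /orP[/eqP e|//] := H _ _ ny nd def_c.
move/(congr1 size): def_c; rewrite -e size_cat -[LHS]add0n => /addIn.
by case: (y) ny.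
Qed.

Lemma lexse_suffix_cat c d :
  lyndon c -> d != [::] -> lexse c (d ++ c) -> lexse c d.
Proof.
move=> lc nd; rewrite !lexseNgt; apply: contra.
exact: lyndon_prefix_lt.
Qed.

(** The standard factorization, with [b] the least proper suffix. The last clause contains the side
    condition on Lyndon-Shirshov bracketings, for every proper suffix of [a] and not only for its
    right factor. *)
Lemma lyndon_split s : lyndon s -> 1 < size s ->
  exists a b, [/\ s = a ++ b, a != [::], lyndon a, lyndon b &
    forall x a2, x != [::] -> a2 != [::] -> a = x ++ a2 -> lexse b a2].
Proof.
move=> [_ ls]; case: s ls => [//|e [//|f s]] ls _.
have [//|x [b [def_b nb minb]]] := @min_suffix (f :: s).
have lb: lyndon b.
  apply: lyndon_min => // y d _ nd def_c; apply: (minb (x ++ y)) => //.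
  by rewrite -catA -def_c.
have def_s: e :: f :: s = (e :: x) ++ b by rewrite /= def_b.
exists (e :: x), b; split=> //.
- split=> // y z ny nz def_a.
  have nzb: z ++ b != [::] by case: (z) nz.
  have szb: lexs (e :: f :: s) (z ++ b).
    by apply: (ls y) => //; rewrite def_s def_a catA.
  have /or3P[//|/eqP/(congr1 size)|] := lexs_total (e :: x) z.
    by rewrite def_a size_cat -[RHS]add0n => /addIn/eqP; rewrite size_eq0 (negPf ny).
  (* If the left part is $zv$, then $zvb < zb$ forces $vb < b$, against the minimality of [b]. *)
  case/lexsP=> [v nv def_x|/(_ b b)]; last first.
    by rewrite -def_s => /(lexs_trans szb); rewrite lexs_irr.
  have: lexse b (v ++ b).
    have: f :: s = behead z ++ v ++ b.
      by move: def_s; rewrite def_x -catA; case: (z) nz => //= ? ? _ [].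
    by move=> /minb; apply; case: (v) nv.
  by rewrite lexseNgt; case/negP; rewrite -(lexs_cat2l z) catA -def_x -def_s.
- move=> y a2 ny na def_a; apply: lexse_suffix_cat => //.
  have: f :: s = behead y ++ a2 ++ b.
    by move: def_s; rewrite def_a -catA; case: (y) ny => //= ? ? _ [].
  by move=> /minb; apply; case: (a2) na.
Qed.

(** The last factor is the least suffix [c]. If [d] is the factor before it, then $c \le dc$ by
    minimality, hence $c \le d$ by [lexse_suffix_cat]. *)
Lemma lyndon_factorization s : s != [::] ->
  exists cs : seq (seq L), [/\ cs != [::], s = flatten cs,
    (forall c, c \in cs -> lyndon c) & sorted (fun c d => lexse d c) cs].
Proof.
have [n] := ubnP (size s); elim: n s => // n IH s /ltnSE les ns.
have [x [c [def_s nc minc]]] := min_suffix ns.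
have lc: lyndon c.
  by apply: lyndon_min => // y d _ nd def_c; apply: (minc (x ++ y)); rewrite // -catA -def_c.
case: (eqVneq x [::]) => [x0|nx].
  exists [:: c]; split=> //=; first by rewrite def_s x0 cats0.
  by move=> d; rewrite inE => /eqP->.
have [||cs [ncs def_x lcs scs]] := IH x => //.
  by apply: leq_trans les; rewrite def_s size_cat -addn1 leq_add2l lt0n size_eq0.
exists (rcons cs c); split; first by case: (cs).
- by rewrite def_s def_x flatten_rcons.
- by move=> d; rewrite mem_rcons inE => /orP[/eqP->//|]; apply: lcs.
case/lastP: cs ncs def_x lcs scs => // cs d _ def_x lcs scs.
rewrite -!cats1 -catA /=; move: scs; rewrite -cats1.
case: cs lcs def_x => [|e cs] lcs def_x /=.
  rewrite andbT => _; move: minc; rewrite def_s def_x /= cats0 => minc.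
  have [nd _] := lcs d (mem_head _ _).
  by apply: lexse_suffix_cat => //; apply: (minc [::]) => //; case: (d) nd.
rewrite !cat_path /= !andbT => /andP[-> ->] /=.
have [nd _]: lyndon d by apply: lcs; rewrite mem_rcons mem_head.
apply: lexse_suffix_cat => //; apply: (minc (flatten (e :: cs))); last by case: (d) nd.
by rewrite def_s def_x flatten_rcons -catA.
Qed.

Lemma bounded_seqs (s : seq L) n :
  exists Om : seq (seq L), forall t, size t <= n -> {subset t <= s} -> t \in Om.
Proof.
elim: n => [|n [Om IH]]; first by exists [:: [::]] => -[].
exists ([::] :: [seq a :: t | a <- s, t <- Om]) => -[//|a t] /= le sub.
rewrite inE; apply/allpairsP; exists (a, t); split=> //=.
  by apply: sub; rewrite mem_head.
by apply: IH => // b bt; apply: sub; rewrite inE bt orbT.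
Qed.

(* [lexs] is not well-founded, but it is on words of bounded length over
   finitely many letters, such as the words of a fixed multidegree. *)
Lemma lexs_bounded_ind (s : seq L) n (P : seq L -> Prop) :
  (forall t, size t <= n -> {subset t <= s} ->
     (forall u, size u <= n -> {subset u <= s} -> lexs u t -> P u) -> P t) ->
  forall t, size t <= n -> {subset t <= s} -> P t.
Proof.
move=> H; have [Om Omp] := bounded_seqs s n.
move=> t; have [m] := ubnP (count (lexs^~ t) Om); elim: m t => // m IH t /ltnSE le st ss.
apply: H => // u su us ut; apply: IH => //; apply: leq_trans le.
have sub: subpred (predU (lexs^~ u) (pred1 u)) (lexs^~ t).
  by move=> v /orP[vu|/eqP->//]; apply: lexs_trans vu ut.
apply: leq_trans (sub_count sub Om).
have := count_predUI (lexs^~ u) (pred1 u) Om.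
rewrite (@eq_count _ (predI _ _) pred0) ?count_pred0 ?addn0 => [->|v /=]; last first.
  by case: eqVneq => [->|_]; rewrite ?lexs_irr ?andbF.
by rewrite -addn1 leq_add2l -has_count has_pred1 Omp.
Qed.

End Lyndon.

(** Levi's lemma; equal cut points go to the first alternative, so that [d] is nonempty in the
    second. *)
Lemma cat_eq_cat (T : eqType) (a b x y : seq T) : a ++ b = x ++ y ->
  (exists2 d, x = a ++ d & b = d ++ y) \/
  (exists d, [/\ d != [::], a = x ++ d & y = d ++ b]).
Proof.
elim: a x => [|e a IH] [|f x] /=.
- by move=> ->; left; exists [::].
- by move=> ->; left; exists (f :: x).
- by move=> <-; right; exists (e :: a).
- case=> <- /IH[[d -> ->]|[d [nd -> ->]]]; first by left; exists d.
  by right; exists d.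
Qed.

(** * Words as sequences of letters, and substitution *)

Section Words.
Context (X : Type).
Implicit Types (p : letter X) (s t : seq (letter X)) (u v w : word X).

Fixpoint mkword p s : word X :=
  if s is a :: s' then Defs.Cons p (mkword a s') else Last p.

Lemma letters_mkword p s : letters (mkword p s) = p :: s.
Proof. by elim: s p => //= a s IH p; rewrite IH. Qed.

Lemma letters_inj : injective (@letters X).
Proof.
have ne w : letters w <> [::] by case: w.
elim=> [p|p u IH] [a|a v] //=.
- by case=> ->.
- by case=> _ /esym /ne.
- by case=> _ /ne.
- by case=> -> /IH ->.
Qed.

Lemma letters_nil w : letters w = [::] -> False.
Proof. by case: w. Qed.

Lemma size_letters_gt0 w : 0 < size (letters w). Proof. by case: w. Qed.

Lemma letters_surj s : 0 < size s -> exists w, letters w = s.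
Proof. by case: s => // a s _; exists (mkword a s); rewrite letters_mkword. Qed.

Lemma letters_wcat u v : letters (wcat u v) = letters u ++ letters v.
Proof. by elim: u => //= p u ->. Qed.

Lemma wcatA u v w : wcat u (wcat v w) = wcat (wcat u v) w.
Proof. by apply: letters_inj; rewrite !letters_wcat catA. Qed.

Lemma size_letters1 w p : letters w = [:: p] -> w = Last p.
Proof. by move=> e; apply: letters_inj. Qed.

End Words.

Lemma wsubst_wcat (X Y : Type) (f : X -> word Y) u v :
  wsubst f (wcat u v) = wcat (wsubst f u) (wsubst f v).
Proof. by elim: u => //= p u ->; rewrite wcatA. Qed.

Section Substitution.
Context (X Y T : Type).

Lemma letters_wsubst (f : X -> word Y) w :
  letters (wsubst f w) = flatten [seq letters (lsubst f p) | p <- letters w].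
Proof. by elim: w => [p|p w IH] /=; rewrite ?cats0 // letters_wcat IH. Qed.

Lemma wsubst_comp (g : Y -> word T) (f : X -> word Y) w :
  wsubst g (wsubst f w) = wsubst (fun x => wsubst g (f x)) w.
Proof.
apply: (@word_letter_rect X
  (fun w => wsubst g (wsubst f w) = wsubst (fun x => wsubst g (f x)) w)
  (fun p => wsubst g (lsubst f p) = lsubst (fun x => wsubst g (f x)) p)) => //=.
- by move=> p IHp u IHu; rewrite wsubst_wcat IHp IHu.
- by move=> u ->.
Qed.

Lemma eq_wsubst (f g : X -> word Y) w :
  (forall x, f x = g x) -> wsubst f w = wsubst g w.
Proof.
move=> e; apply: (@word_letter_rect X
  (fun w => wsubst f w = wsubst g w) (fun p => lsubst f p = lsubst g p)) => //=.
- by move=> p -> u ->.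
- by move=> u ->.
Qed.

Lemma wsubst_gen w : wsubst (@gen X) w = w.
Proof.
apply: (@word_letter_rect X
  (fun w => wsubst (@gen X) w = w) (fun p => lsubst (@gen X) p = Last p)) => //=.
- by move=> p -> u /= ->.
- by move=> u ->.
Qed.

End Substitution.

(** Induction on bracket depth: one level of a word is treated as a flat sequence of letters, and
    the hypothesis speaks of the contents of its brackets. *)
Lemma word_nest_ind (X : choiceType) (P : word X -> Prop) :
  (forall w, (forall w', Brk w' \in letters w -> P w') -> P w) -> forall w, P w.
Proof.
move=> H w; have [] //: P w /\ forall w', Brk w' \in letters w -> P w'.
apply: (@word_letter_rect X (fun w => P w /\ forall w', Brk w' \in letters w -> P w')
  (fun p => if p is Brk w' then P w' else True)) => //=.
- move=> p Hp; have sub w' : Brk w' \in [:: p] -> P w'.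
    by rewrite inE => /eqP e; rewrite -e in Hp.
  by split=> //; apply: H.
- move=> p Hp u [_ Hu]; have sub w' : Brk w' \in p :: letters u -> P w'.
    by rewrite inE => /orP[/eqP e|]; [rewrite -e in Hp|apply: Hu].
  by split=> //; apply: H.
- by move=> u [].
Qed.

(** * Contexts and the relative position of two occurrences *)

Section Contexts.
Context (Z : choiceType).
Implicit Types (u v w : word Z) (q r : word (option Z)).
Implicit Types (p : letter (option Z)) (s t : seq (letter Z)).

Definition llift (p : letter Z) : letter (option Z) :=
  match p with Gen z => Gen (Some z) | Brk w => Brk (wlift w) end.

Lemma letters_wlift w : letters (wlift w) = map llift (letters w).
Proof.
rewrite letters_wsubst; elim: (letters w) => //= a s ->.
by case: a.
Qed.

Lemma plug_wlift w u : plug (wlift w) u = w.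
Proof.
by rewrite /plug /wlift wsubst_comp -[RHS]wsubst_gen; apply: eq_wsubst.
Qed.

Lemma plug_star_wlift w q : plug_star (wlift w) q = wlift w.
Proof. by rewrite /plug_star /wlift wsubst_comp; apply: eq_wsubst. Qed.

Lemma plug_wcat q r u : plug (wcat q r) u = wcat (plug q u) (plug r u).
Proof. exact: wsubst_wcat. Qed.

Lemma plug_star_wcat q r q' :
  plug_star (wcat q r) q' = wcat (plug_star q q') (plug_star r q').
Proof. exact: wsubst_wcat. Qed.

Lemma plug_comp q r u : plug (plug_star q r) u = plug q (plug r u).
Proof. by rewrite /plug wsubst_comp; apply: eq_wsubst; case. Qed.

Lemma plug_starA q r r' :
  plug_star (plug_star q r) r' = plug_star q (plug_star r r').
Proof. by rewrite /plug_star wsubst_comp; apply: eq_wsubst; case. Qed.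

Lemma nstars_wcat q r : nstars (wcat q r) = nstars q + nstars r.
Proof. by elim: q => //= p q ->; rewrite addnA. Qed.

Lemma nstars_wlift w : nstars (wlift w) = 0.
Proof.
move: w; apply: (@word_letter_rect Z (fun w => nstars (wlift w) = 0)
  (fun p : letter Z => nstars_letter (llift p) = 0)) => //=.
- by case.
- by move=> p Hp u Hu; rewrite /wlift /= nstars_wcat Hu addn0; case: p Hp.
Qed.

Lemma nstars_llift (a : letter Z) : nstars_letter (llift a) = 0.
Proof. by case: a => //= w; rewrite nstars_wlift. Qed.

Lemma nstars_plug_star q r : nstars (plug_star q r) = nstars q * nstars r.
Proof.
move: q; apply: (@word_letter_rect _ (fun q => nstars (plug_star q r) = nstars q * nstars r)
  (fun p => nstars (lsubst (fun o => if o is Some x then gen (Some x) else r) p)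
            = nstars_letter p * nstars r)) => //=.
- by move=> p Hp u Hu; rewrite /plug_star /= nstars_wcat Hp mulnDl -Hu.
- by case=> //; rewrite mul1n.
Qed.

Lemma starred_star : starred (@star Z). Proof. by []. Qed.

Lemma starred_plug_star q r : starred q -> starred r -> starred (plug_star q r).
Proof. by rewrite /starred nstars_plug_star => /eqP-> /eqP->. Qed.

Lemma starred_wcatl q u : starred q -> starred (wcat q (wlift u)).
Proof. by rewrite /starred nstars_wcat nstars_wlift addn0. Qed.

Lemma starred_wcatr q u : starred q -> starred (wcat (wlift u) q).
Proof. by rewrite /starred nstars_wcat nstars_wlift. Qed.

Lemma nstars0 q : nstars q = 0 -> exists w, q = wlift w.
Proof.
move: q; apply: (@word_letter_rect _ (fun q => nstars q = 0 -> exists w, q = wlift w)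
  (fun p => nstars_letter p = 0 -> exists a : letter Z, p = llift a)) => //=.
- by move=> p Hp /Hp[p' ->]; exists (Last p'); apply: letters_inj; rewrite letters_wlift.
- move=> p Hp u Hu /eqP; rewrite addn_eq0 => /andP[/eqP/Hp[p' ->] /eqP/Hu[w ->]].
  by exists (Defs.Cons p' w); apply: letters_inj; rewrite /= !letters_wlift.
- by case=> // z _; exists (Gen z).
- by move=> u Hu /Hu[w ->]; exists (Brk w).
Qed.

(* [p] is the letter containing the hole. *)
Definition ctx s p t : word (option Z) :=
  foldr (@Defs.Cons _) (mkword p (map llift t)) (map llift s).

Definition hole_letter p : Prop :=
  p = Gen None \/ exists2 q, starred q & p = Brk q.

Definition lplug p u : word Z :=
  lsubst (fun o => if o is Some x then gen x else u) p.

Lemma letters_ctx s p t : letters (ctx s p t) = map llift s ++ p :: map llift t.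
Proof. by rewrite /ctx; elim: s => /= [|a s ->]; rewrite ?letters_mkword. Qed.

Lemma letters_plug_ctx s p t u :
  letters (plug (ctx s p t) u) = s ++ letters (lplug p u) ++ t.
Proof.
rewrite letters_wsubst letters_ctx map_cat flatten_cat /=.
have lift s' : flatten [seq letters (lsubst (fun o => if o is Some x then gen x else u) p)
                 | p <- [seq llift i | i <- s']] = s'.
  elim: s' => //= a s' ->; case: a => //= w.
  by rewrite -/(plug (wlift w) u) plug_wlift.
by rewrite !lift.
Qed.

Lemma letters_plug_star_ctx s p t q :
  letters (plug_star (ctx s p t) q) =
  map llift s ++ letters (lsubst (fun o => if o is Some x then gen (Some x) else q) p)
    ++ map llift t.
Proof.
rewrite letters_wsubst letters_ctx map_cat flatten_cat /=.
have lift s' : flatten [seq letters (lsubst (fun o => if o is Some x then gen (Some x) else q) p)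
                 | p <- [seq llift i | i <- s']] = map llift s'.
  elim: s' => //= a s' ->; case: a => //= w.
  by rewrite -/(plug_star (wlift w) q) plug_star_wlift.
by rewrite !lift.
Qed.

Lemma ctx_starred s p t : hole_letter p -> starred (ctx s p t).
Proof.
move=> hp; rewrite /starred /ctx.
have np: nstars_letter p = 1 by case: hp => [->//|[q /eqP qs ->]].
have nt a t' : nstars (mkword a (map llift t')) = nstars_letter a.
  by elim: t' a => //= b t' IH a; rewrite IH nstars_llift addn0.
elim: s => /= [|a s IH]; first by rewrite nt np.
by rewrite (eqP IH) nstars_llift.
Qed.

Lemma starred_ctx q : starred q -> exists s p t, q = ctx s p t /\ hole_letter p.
Proof.
move=> sq; elim: q sq => [p|p q IH]; rewrite /starred /=.
  move=> sp; exists [::], p, [::]; split=> //.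
  by case: p sp => [[]|q] // sq; [left|right; exists q].
case np: (nstars_letter p) => [|n]; last first.
  rewrite addSn eqSS addn_eq0 => /andP[/eqP n0 /eqP /nstars0[w ->]].
  exists [::], p, (letters w); split.
    by apply: letters_inj; rewrite letters_ctx /= letters_wlift.
  by case: p np => [[]|r] //= sr; [left|right; exists r; rewrite // /starred sr n0].
rewrite add0n => /IH[s [p' [t [-> hp']]]].
have [|w] := @nstars0 (Last p); first exact: np.
move/(congr1 (@letters _)); rewrite letters_wlift.
case def_w: (letters w) => [|a [|b l]] //= [->].
exists (a :: s), p', t; split=> //.
Qed.

Lemma ctx_brk s q t :
  ctx s (Brk q) t = plug_star (ctx s (Brk star) t) q.
Proof. by apply: letters_inj; rewrite letters_plug_star_ctx letters_ctx. Qed.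

Lemma hole_letter_star : hole_letter (Gen None). Proof. by left. Qed.
Lemma hole_letter_brk q : starred q -> hole_letter (Brk q).
Proof. by right; exists q. Qed.

Lemma plug_wcat_split q u a b :
  starred q -> plug q u = wcat a b ->
  [\/ exists q', [/\ starred q', plug q' u = a & q = wcat q' (wlift b)],
      exists q', [/\ starred q', plug q' u = b & q = wcat (wlift a) q'] |
      exists x a2 b1 y,
        [/\ letters a = x ++ a2, letters b = b1 ++ y, a2 != [::] /\ b1 != [::],
            letters u = a2 ++ b1 & q = ctx x (Gen None) y]].
Proof.
move=> /starred_ctx[s [p [t [-> hp]]]] /(congr1 (@letters _)).
rewrite letters_plug_ctx letters_wcat => e.
case/cat_eq_cat: (esym e) => [[d -> def_b]|[d [nd def_a {}e]]].
  constructor 2; exists (ctx d p t); split; first exact: ctx_starred.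
    by apply: letters_inj; rewrite letters_plug_ctx.
  by apply: letters_inj; rewrite letters_wcat letters_wlift !letters_ctx map_cat catA.
case/cat_eq_cat: e => [[f def_d def_t]|[f [nf def_u def_b]]].
  constructor 1; exists (ctx s p f); split; first exact: ctx_starred.
    by apply: letters_inj; rewrite letters_plug_ctx def_a def_d.
  apply: letters_inj; rewrite letters_wcat letters_wlift !letters_ctx def_t.
  by rewrite -catA /= map_cat.
(* The letters [d ++ f] all come from [p]. They are at least two, so [p] is not a bracket and the
   hole is on the top level. *)
have pE: p = Gen None.
  case: hp def_u => // -[q' _ ->] /= /(congr1 size).
  by rewrite size_cat /=; case: (d) nd => // ? ?; case: (f) nf => //= ? ? _ _; rewrite addnS.
constructor 3; exists s, d, f, t; split=> //; last by rewrite pE.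
by rewrite -def_u pE.
Qed.

(** [OccDisjoint] encodes a context with two holes by the two families of contexts that arise when
    one hole is filled. In [OccOverlap] the bound on [y] says that the occurrences share a
    letter. *)
Variant occurrences q1 u1 q2 u2 : Prop :=
  | OccNested r of starred r & q2 = plug_star q1 r & u1 = plug r u2
  | OccOverlap Q x y of starred Q & q1 = plug_star Q (wcat star (wlift y)) &
      q2 = plug_star Q (wcat (wlift x) star) & wcat u1 y = wcat x u2 &
      breadth y < breadth u2
  | OccDisjoint G1 G2 of
      (forall v, starred (G1 v)) & (forall v, starred (G2 v)) &
      q1 = G1 u2 & q2 = G2 u1 &
      (forall v1 v2, plug (G1 v2) v1 = plug (G2 v1) v2).

Lemma occurrences_ctx Q q1 u1 q2 u2 : starred Q ->
  occurrences q1 u1 q2 u2 ->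
  occurrences (plug_star Q q1) u1 (plug_star Q q2) u2.
Proof.
move=> sQ; case=> [r sr -> ->|Q' x y sQ' -> -> e b|G1 G2 s1 s2 -> -> e].
- by apply: (@OccNested _ _ _ _ r); rewrite // plug_starA.
- by apply: (@OccOverlap _ _ _ _ (plug_star Q Q') x y);
    rewrite ?plug_starA // starred_plug_star.
- apply: (@OccDisjoint _ _ _ _ (fun v => plug_star Q (G1 v)) (fun v => plug_star Q (G2 v)));
    rewrite // => *; rewrite ?starred_plug_star // !plug_comp e //.
Qed.

Lemma cat3_cases (T : eqType) (X1 U1 Y1 X2 U2 Y2 : seq T) :
  X1 ++ U1 ++ Y1 = X2 ++ U2 ++ Y2 -> size X1 <= size X2 ->
  exists2 d, X2 = X1 ++ d &
    [\/ exists2 e, d = U1 ++ e & Y1 = e ++ U2 ++ Y2,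
        exists2 e, U1 = d ++ U2 ++ e & Y2 = e ++ Y1 |
        exists m z, [/\ U1 = d ++ m, U2 = m ++ z, Y1 = z ++ Y2, m != [::] & z != [::]]].
Proof.
case/cat_eq_cat=> [[d -> e] _|[d [nd -> _]]]; last first.
  by rewrite size_cat -{2}[size X2]addn0 leq_add2l leqn0 size_eq0 (negPf nd).
exists d => //; case/cat_eq_cat: e => [[e -> ->]|[m [nm -> e]]].
  by constructor 1; exists e.
case/cat_eq_cat: e => [[e -> ->]|[z [nz -> ->]]]; first by constructor 2; exists e.
by constructor 3; exists m, z.
Qed.

(** Induction on bracket depth. At the top level both occurrences are segments of one sequence of
    letters; the induction hypothesis is called only when both holes lie inside the same bracket. *)
Lemma occurrencesP q1 u1 q2 u2 :
  starred q1 -> starred q2 -> plug q1 u1 = plug q2 u2 ->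
  occurrences q1 u1 q2 u2 \/ occurrences q2 u2 q1 u1.
Proof.
elim/word_nest_ind: q1 u1 q2 u2.
suff wl q1 u1 q2 u2 :
  (forall q q', Brk q \in letters q1 -> Brk q' \in letters q2 ->
    starred q -> starred q' -> plug q u1 = plug q' u2 ->
    occurrences q u1 q' u2 \/ occurrences q' u2 q u1) ->
  forall s1 p1 t1 s2 p2 t2, q1 = ctx s1 p1 t1 -> q2 = ctx s2 p2 t2 ->
  hole_letter p1 -> hole_letter p2 ->
  plug q1 u1 = plug q2 u2 -> size s1 <= size s2 ->
  occurrences q1 u1 q2 u2 \/ occurrences q2 u2 q1 u1.
  move=> q1 IH u1 q2 u2 sq1 sq2 e.
  have [s1 [p1 [t1 [e1 h1]]]] := starred_ctx sq1.
  have [s2 [p2 [t2 [e2 h2]]]] := starred_ctx sq2.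
  have [le|/ltnW le] := leqP (size s1) (size s2).
    by apply: (wl _ _ _ _ _ _ _ _ _ _ _ e1 e2) => // q q' qin _; apply: IH.
  apply/or_comm; apply: (wl _ _ _ _ _ _ _ _ _ _ _ e2 e1) => // q q' _ qin sq sq' ee.
  by apply/or_comm; apply: IH.
move=> IH s1 p1 t1 s2 p2 t2 e1 e2 h1 h2.
rewrite e1 e2 => /(congr1 (@letters _)); rewrite !letters_plug_ctx.
move=> /cat3_cases cases /cases[d def_s2 {cases}[]].
- case=> e def_d def_t1; left.
  apply: (@OccDisjoint _ _ _ _
    (fun v => ctx s1 p1 (e ++ letters (lplug p2 v) ++ t2))
    (fun v => ctx (s1 ++ letters (lplug p1 v) ++ e) p2 t2)).
  + by move=> v; apply: ctx_starred.
  + by move=> v; apply: ctx_starred.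
  + by rewrite def_t1.
  + by rewrite def_s2 def_d.
  + by move=> v1 v2; apply: letters_inj; rewrite !letters_plug_ctx -!catA.
- case=> e def_U1 def_t2.
  case: h1 def_U1 => [p1E|[q sq p1E]]; rewrite p1E /=.
    move=> def_u1; left; apply: (@OccNested _ _ _ _ (ctx d p2 e)).
    + exact: ctx_starred.
    + apply: letters_inj; rewrite letters_plug_star_ctx /= !letters_ctx.
      by rewrite def_s2 def_t2 !map_cat /= -!catA.
    + by apply: letters_inj; rewrite letters_plug_ctx.
  (* The first occurrence lies inside one bracket letter and the second segment is not empty, so
     both segments are this letter. *)
  move=> def_U1; have [d0 e0]: d = [::] /\ e = [::].
    move/(congr1 size): def_U1; rewrite !size_cat /=.
    have := size_letters_gt0 (lplug p2 u2); case: (d) => [|? ?]; case: (e) => [|? ?] //=;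
      case: (letters _) => //= ? l; rewrite ?addSn ?addnS //.
  move: def_U1; rewrite d0 e0 cats0 /= => def_U1.
  have s12: s2 = s1 by rewrite def_s2 d0 cats0.
  have t12: t2 = t1 by rewrite def_t2 e0.
  case: h2 def_U1 => [p2E|[q' sq' p2E]]; rewrite p2E /=.
    move=> /esym/size_letters1 def_u2; right; apply: (@OccNested _ _ _ _ (brk q)).
    + exact: sq.
    + by apply: letters_inj; rewrite letters_plug_star_ctx letters_ctx s12 t12.
    + exact: def_u2.
  case=> eq'; rewrite ctx_brk [ctx s2 _ _]ctx_brk s12 t12.
  have sC: starred (ctx s1 (Brk (@star Z)) t1) by apply/ctx_starred/hole_letter_brk.
  have q1in: Brk q \in letters q1 by rewrite e1 letters_ctx mem_cat p1E mem_head orbT.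
  have q2in: Brk q' \in letters q2 by rewrite e2 letters_ctx mem_cat p2E mem_head orbT.
  by case: (IH _ _ q1in q2in sq sq' eq') => occ; [left|right]; apply: occurrences_ctx.
- case=> m [z [def_U1 def_U2 def_t1 nm nz]].
  have p2E: p2 = Gen None.
    case: h2 def_U2 => // -[q' _ ->] /= /(congr1 size) /=; rewrite size_cat.
    by case: (m) nm => // ? ?; case: (z) nz => //= ? ? _ _; rewrite addnS.
  (* With a common starting point the first occurrence is an initial segment of the second: this is
     nesting, not overlap. *)
  have [d0|nd] := eqVneq d [::].
    right; apply: (@OccNested _ _ _ _ (ctx [::] p1 z)).
    + exact: ctx_starred.
    + apply: letters_inj; rewrite p2E letters_plug_star_ctx /= !letters_ctx.
      by rewrite def_s2 d0 cats0 def_t1 map_cat.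
    + apply: letters_inj; rewrite letters_plug_ctx def_U1 d0 /=.
      by move: def_U2; rewrite p2E.
  have p1E: p1 = Gen None.
    case: h1 def_U1 => // -[q' _ ->] /= /(congr1 size) /=; rewrite size_cat.
    by case: (m) nm => // ? ?; case: (d) nd => //= ? ? _ _; rewrite addnS.
  move: def_U1 def_U2; rewrite p1E p2E /= => def_U1 def_U2.
  have [|x def_x] := @letters_surj _ d; first by case: (d) nd.
  have [|y def_y] := @letters_surj _ z; first by case: (z) nz.
  left; apply: (@OccOverlap _ _ _ _ (ctx s1 (Gen None) t2) x y).
  + exact/ctx_starred/hole_letter_star.
  + apply: letters_inj; rewrite letters_plug_star_ctx /= !letters_ctx def_t1.
    by rewrite letters_wlift def_y map_cat.
  + apply: letters_inj; rewrite letters_plug_star_ctx !letters_wcat /= !letters_ctx def_s2.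
    by rewrite letters_wlift def_x map_cat -!catA.
  + by apply: letters_inj; rewrite !letters_wcat def_U1 def_U2 def_x def_y catA.
  + by rewrite /breadth def_U2 def_y size_cat -{1}[size z]add0n ltn_add2r; case: (m) nm.
Qed.

End Contexts.

Lemma wcat_Last (X : Type) (u v : word X) p : wcat u v <> Last p.
Proof. by case: u. Qed.

Lemma letters_chain (X : Type) (u : word X) cs :
  letters (foldl (@wcat _) u cs) = letters u ++ flatten (map (@letters X) cs).
Proof.
elim: cs u => /= [|c cs IH] u; first by rewrite cats0.
by rewrite IH letters_wcat catA.
Qed.

(** * Monomial orders and Lyndon-Shirshov bracketings *)

Section MonomialOrder.
Context (Z : choiceType) (le : rel (word Z)).
Hypothesis le_mono : monomial_order le.
Implicit Types (u v w : word Z).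

Let le_wo : well_order le := proj1 le_mono.
Let le_chain : wo_chain le predT := @withinW _ predT _ le_wo.

Lemma mo_total : total le.
Proof. by move=> x y; apply: (wo_chainW le_chain). Qed.

Lemma mo_refl : reflexive le.
Proof. by move=> x; apply: (wo_chain_reflexive le_chain). Qed.

Lemma mo_anti : antisymmetric le.
Proof. by move=> x y; apply: (wo_chain_antisymmetric le_chain). Qed.

Lemma mo_trans : transitive le.
Proof.
move=> y x z xy yz.
(* [well_order] provides least elements; transitivity is read off the least of the three words. *)
have [|m [[min_in /allP/= /and4P[mx my mz _]] _]] := le_wo (A := [pred t | t \in [:: x; y; z]]).
  by exists x; rewrite !inE eqxx.
move: min_in; rewrite !inE => /or3P[]/eqP e; rewrite e in mx my mz => //.
  by rewrite (_ : x = y) //; apply: mo_anti; rewrite xy mx.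
by rewrite (_ : z = y) //; apply: mo_anti; rewrite yz my.
Qed.

Lemma wlt_irr u : wlt le u u = false. Proof. by rewrite /wlt eqxx. Qed.

Lemma wltW u v : wlt le u v -> le u v. Proof. by case/andP. Qed.

Lemma wlt_le_trans u v w : wlt le u v -> le v w -> wlt le u w.
Proof.
case/andP=> nuv uv vw; rewrite /wlt (mo_trans uv vw) andbT.
by apply: contraNneq nuv => e; apply/eqP/mo_anti; rewrite uv e.
Qed.

Lemma le_wlt_trans u v w : le u v -> wlt le v w -> wlt le u w.
Proof.
move=> uv /andP[nvw vw]; rewrite /wlt (mo_trans uv vw) andbT.
by apply: contraNneq nvw => e; apply/eqP/mo_anti; rewrite vw -e.
Qed.

Lemma wlt_trans u v w : wlt le u v -> wlt le v w -> wlt le u w.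
Proof. by move=> uv /wltW; apply: wlt_le_trans. Qed.

Lemma le_eqVwlt u v : le u v = (u == v) || wlt le u v.
Proof. by rewrite /wlt; case: eqVneq => [->|] //=; rewrite mo_refl. Qed.

Lemma wlt_total u v : [|| wlt le u v, u == v | wlt le v u].
Proof.
rewrite /wlt (eq_sym v); case: eqVneq => //= _.
by have := mo_total u v.
Qed.

Lemma wlt_ind (P : word Z -> Prop) :
  (forall w, (forall v, wlt le v w -> P v) -> P w) -> forall w, P w.
Proof.
move=> H w; apply: contrapT => nPw.
have [|m [[min_in lb] _]] := le_wo (A := [pred t | ~~ `[< P t >]]).
  by exists w; apply/asboolPn.
case/asboolPn: min_in; apply: H => v vm; apply: contrapT => /asboolPn nPv.
by have := lb v nPv => /(wlt_le_trans vm); rewrite wlt_irr.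
Qed.

Lemma wlt_plug q u v : starred q -> wlt le u v -> wlt le (plug q u) (plug q v).
Proof. exact: (proj2 le_mono). Qed.

Lemma wlt_brk u v : wlt le u v -> wlt le (brk u) (brk v).
Proof. exact: (@wlt_plug (brk star)). Qed.

Lemma wlt_catl w u v : wlt le u v -> wlt le (wcat u w) (wcat v w).
Proof.
move/(wlt_plug (starred_wcatl w (starred_star Z))).
by rewrite !plug_wcat !plug_wlift.
Qed.

Lemma wlt_catr w u v : wlt le u v -> wlt le (wcat w u) (wcat w v).
Proof.
move/(wlt_plug (starred_wcatr w (starred_star Z))).
by rewrite !plug_wcat !plug_wlift.
Qed.

Lemma wlt_cat u u' v v' : wlt le u u' -> le v v' -> wlt le (wcat u v) (wcat u' v').
Proof.
rewrite le_eqVwlt => uu /orP[/eqP <-|vv]; first exact: wlt_catl.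
exact: wlt_trans (wlt_catl _ uu) (wlt_catr _ vv).
Qed.

Lemma wlt_cat' u u' v v' : le u u' -> wlt le v v' -> wlt le (wcat u v) (wcat u' v').
Proof.
rewrite le_eqVwlt => /orP[/eqP <-|uu] vv; first exact: wlt_catr.
exact: wlt_trans (wlt_catl _ uu) (wlt_catr _ vv).
Qed.

Definition rlt (a b : letter Z) : bool := wlt le (Last b) (Last a).
Local Notation lexs := (lexs rlt).
Local Notation lexse := (lexse rlt).
Local Notation lyndon := (lyndon rlt).

Lemma rlt_irr : irreflexive rlt. Proof. by move=> a; apply: wlt_irr. Qed.
Lemma rlt_trans : transitive rlt.
Proof. by move=> b a c ab bc; apply: wlt_trans bc ab. Qed.
Lemma rlt_total a b : [|| rlt a b, a == b | rlt b a].
Proof.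
have := wlt_total (Last b) (Last a); rewrite /rlt.
by case/or3P=> [->//|/eqP[->]|->]; rewrite ?eqxx ?orbT.
Qed.
Let irr := rlt_irr. Let tr := rlt_trans. Let tot := rlt_total.

Lemma lexgtE s t : lexgt le s t = lexs s t.
Proof. by elim: s t => [|a s IH] [|b t] //=; rewrite IH. Qed.

Lemma lexgeE s t : lexge le s t = lexse s t.
Proof. by rewrite /lexge lexgtE. Qed.

Lemma wlexgeE u v : wlexge le u v = lexse (letters u) (letters v).
Proof. exact: lexgeE. Qed.

Lemma alswP w : alsw le w <-> lyndon (letters w).
Proof.
split=> [H|/(lyndonP irr tr tot)[_ H] u v e].
  apply/(lyndonP irr tr tot); split=> [|x y nx ny e]; first by case: (w).
  have [|u def_u] := @letters_surj _ x; first by case: (x) nx.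
  have [|v def_v] := @letters_surj _ y; first by case: (y) ny.
  rewrite -def_u -def_v -!letters_wcat -lexgtE; apply: H.
  by apply: letters_inj; rewrite letters_wcat def_u def_v.
rewrite /wlexgt lexgtE !letters_wcat; apply: H.
- by case: (u).
- by case: (v).
- by rewrite e letters_wcat.
Qed.

Lemma alsbw_n_mono n m w : n <= m -> alsbw_n le n w -> alsbw_n le m w.
Proof.
elim: n m w => [|n IH] [|m] w //= le_nm [aw H]; split=> // w' /H //.
exact: IH.
Qed.

(** A word has finitely many letters, so the largest depth among its brackets serves for all of
    them. *)
Lemma alsbwP w :
  alsbw le w <-> alsw le w /\ forall w', Brk w' \in letters w -> alsbw le w'.
Proof.
split=> [[[|n] /= [aw H]]|[aw H]]; first by split=> // w' /H.
  by split=> // w' /H; exists n.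
have [n Hn]: exists n, forall w', Brk w' \in letters w -> alsbw_n le n w'.
  elim: (letters w) H => [|a s IH] H; first by exists 0.
  have [|n Hn] := IH; first by move=> w' w's; apply: H; rewrite inE w's orbT.
  case: a H => [z|v] H; first by exists n => w'; rewrite inE => /= /Hn.
  have [m Hm] := H v (mem_head _ _).
  exists (maxn m n) => w'; rewrite inE => /orP[/eqP[->]|/Hn].
    exact: alsbw_n_mono (leq_maxl _ _) Hm.
  exact: alsbw_n_mono (leq_maxr _ _).
by exists n.+1.
Qed.

Lemma alsbw_lyndon w : alsbw le w -> lyndon (letters w).
Proof. by case/alsbwP=> /alswP. Qed.

Lemma alsbw_sub u w :
  alsbw le w -> lyndon (letters u) -> {subset letters u <= letters w} -> alsbw le u.
Proof.
case/alsbwP=> _ H lu sub; apply/alsbwP; split; first exact/alswP.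
by move=> w' /sub/H.
Qed.

Lemma nls_alsbw t : nls le t -> alsbw le (erase t).
Proof.
elim: t => [z _|t IH /IH at_|a IHa b IHb /= [ab /IHa aa /IHb bb _]].
- by apply/alsbwP; split; [apply/alswP/lyndon1|move=> w'; rewrite inE].
- apply/alsbwP; split; first exact/alswP/lyndon1.
  by move=> w'; rewrite inE => /eqP[->].
- apply/alsbwP; split=> // w'; rewrite letters_wcat mem_cat => /orP[].
    by case/alsbwP: aa => _; apply.
  by case/alsbwP: bb => _; apply.
Qed.

Lemma nls_lyndon t : nls le t -> lyndon (letters (erase t)).
Proof. by move/nls_alsbw/alsbw_lyndon. Qed.

(** For a suffix $db$ with $d$ a proper suffix of $a = (a_1 a_2)$, the side condition and induction
    give $b \le a_2 \le d$. Hence the word alone determines the outermost cut. *)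
Lemma nls_min a b : nls le (NBin a b) ->
  forall x y, x != [::] -> y != [::] ->
    letters (erase a) ++ letters (erase b) = x ++ y -> lexse (letters (erase b)) y.
Proof.
elim: a b => [z|t _|a1 IH1 a2 IH2] b [_ na nb cond] x y nx ny;
  case/cat_eq_cat=> [[[|c d] _ def_b]|[d [nd def_a ->]]].
1,4,7: by rewrite def_b; apply: lexse_refl.
1,3,5: by apply/lexsW/(proj2 (nls_lyndon nb) (c :: d)).
1,2: by case: x nx def_a => [//|e [|? ?]] _ [] //; case: (d) nd.
rewrite wlexgeE in cond; apply: lexse_trans (lexse_catr irr d _) => //.
apply: (lexse_trans tr cond); apply: (IH1 a2 na x d nx nd).
by rewrite -def_a letters_wcat.
Qed.

Lemma nls_uniq s t : nls le s -> nls le t -> erase s = erase t -> s = t.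
Proof.
elim: s t => [z|s IH|a IHa b IHb] [z'|t|a' b'] //=.
- by move=> _ _ [->].
- by move=> _ _ /esym/wcat_Last.
- by move=> ns nt [] /(IH _ ns nt) ->.
- by move=> _ _ /esym/wcat_Last.
- by move=> _ _ /wcat_Last.
- by move=> _ _ /wcat_Last.
move=> ns nt /(congr1 (@letters _)); rewrite !letters_wcat => e.
have ne w : letters w != [::] by case: w.
have le1 := nls_min ns (ne _) (ne _) e.
have le2 := nls_min nt (ne _) (ne _) (esym e).
have eb: letters (erase b) = letters (erase b').
  case/orP: le1 => [/eqP//|lt1]; have := lexs_le_trans tr lt1 le2.
  by rewrite lexs_irr.
have ea: letters (erase a) = letters (erase a').
  have /eqP := e; rewrite eb eqseq_cat; first by case/andP=> /eqP.
  by move/(congr1 size): e; rewrite !size_cat eb => /addIn.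
move: ns nt => [_ na nb _] [_ na' nb' _].
by rewrite (IHa _ na na' (letters_inj ea)) (IHb _ nb nb' (letters_inj eb)).
Qed.

Lemma alsbw_nls w : alsbw le w -> exists2 t, erase t = w & nls le t.
Proof.
elim/word_nest_ind: w => w IHw /alsbwP[/alswP lw Hw].
(* The outer induction goes through brackets, the inner one on the length of [v]. As [v] takes its
   letters from [w], the outer hypothesis still applies to its brackets. *)
suff H v : lyndon (letters v) -> {subset letters v <= letters w} ->
    exists2 t, erase t = v & nls le t by apply: H.
have [n] := ubnP (size (letters v)); elim: n v => // n IH v /ltnSE le_vn lv sub.
have [lt1|] := ltnP 1 (size (letters v)); last first.
  case: v {le_vn lv} sub => [[z|w']|p v] sub //=; last first.
    by case: (letters v) (@letters_nil _ v) => [/(_ erefl)|].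
    have w'w: Brk w' \in letters w by apply: sub; rewrite mem_head.
    by have [t <- nt] := IHw _ w'w (Hw _ w'w); exists (NBrk t).
  by exists (NGen z).
have [x [y [def_v nx lx ly cond]]] := lyndon_split irr tr tot lv lt1.
have [|a def_a] := @letters_surj _ x; first by case: (x) nx.
have ny: y != [::] by case: ly.
have [|b def_b] := @letters_surj _ y; first by case: (y) ny.
have [s def_s ns]: exists2 t, erase t = a & nls le t.
  apply: IH; rewrite def_a //.
    by apply: leq_trans le_vn; rewrite def_v size_cat -addn1 leq_add2l; case: (y) ny.
  by move=> p px; apply: sub; rewrite def_v mem_cat px.
have [t def_t nt]: exists2 t, erase t = b & nls le t.
  apply: IH; rewrite def_b //.
    by apply: leq_trans le_vn; rewrite def_v size_cat -add1n leq_add2r; case: (x) nx.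
  by move=> p px; apply: sub; rewrite def_v mem_cat px orbT.
have e: wcat a b = v by apply: letters_inj; rewrite letters_wcat def_a def_b.
exists (NBin s t); first by rewrite /= def_s def_t.
split=> //; first by apply/alswP; rewrite /= def_s def_t e.
case: (s) def_s => // s1 s2 def_s; rewrite wlexgeE def_t def_b.
apply: (cond (letters (erase s1))); try by case: (letters _) (@letters_nil _ (erase s1)) => [/(_ erefl)|].
  by case: (letters _) (@letters_nil _ (erase s2)) => [/(_ erefl)|].
by rewrite -def_a -def_s letters_wcat.
Qed.

Lemma lsbP w : alsbw le w -> erase (lsb le w) = w /\ nls le (lsb le w).
Proof.
move=> /alsbw_nls[t et nt].
by apply: (@epsilon_spec _ _ (fun t => erase t = w /\ nls le t)); exists t.
Qed.

Lemma lsb_erase t : nls le t -> lsb le (erase t) = t.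
Proof. by move=> nt; have [e n] := lsbP (nls_alsbw nt); apply: nls_uniq. Qed.

(** A partial product is a prefix of the whole Lyndon word, so it is at most that word, which is
    less than its suffix, the last factor, which is at most the next factor; [lyndon_cat] then
    adjoins this factor. *)
Lemma lyndon_chain (u : seq (letter Z)) cs :
  lyndon u -> lyndon (u ++ flatten cs) -> (forall c, c \in cs -> lyndon c) ->
  sorted (fun c d => lexse d c) cs ->
  forall cs1 cs2, cs = cs1 ++ cs2 -> lyndon (u ++ flatten cs1).
Proof.
move=> lu lw lcs scs; elim/last_ind=> [|cs1 d IH] cs2; first by rewrite cats0.
rewrite -cats1 -catA /= => def_cs.
rewrite flatten_cat /= cats0 catA.
have ld: lyndon d by apply: lcs; rewrite def_cs mem_cat mem_head orbT.
apply: (lyndon_cat irr tr) => //; first exact: IH def_cs.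
have le_last: lexse (last d cs2) d.
  have: path (fun c d => lexse d c) d cs2.
    by move: scs; rewrite def_cs; case: (cs1) => //= ? ?; rewrite cat_path => /andP[_ /andP[]].
  elim: cs2 {def_cs} d {ld} => [|e cs2 IHc] d /=; first by rewrite lexse_refl.
  by case/andP=> ed /IHc le_e; apply: (lexse_trans tr le_e).
have le_w: lexse (u ++ flatten cs1) (u ++ flatten cs).
  by rewrite def_cs flatten_cat catA; apply: lexse_catr.
apply: (lexse_lt_trans tr le_w); apply: (lexs_le_trans tr _ le_last).
have [nu _] := lu; have [nl _]: lyndon (last d cs2).
  by apply: lcs; rewrite def_cs lastI -cats1 catA mem_cat mem_head orbT.
apply: (proj2 lw (u ++ flatten (cs1 ++ belast d cs2))) => //; first by case: (u) nu.
by rewrite def_cs lastI -cats1 catA flatten_cat /= cats0 catA.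
Qed.

(** The property of a special bracketing on which the leading-term computation rests. *)
Fixpoint lie_context u (M : nterm (option Z)) : Prop :=
  match M with
  | NGen _ => True
  | NBrk t => lie_context u t
  | NBin a b => [/\ alsw le (wcat (plug (erase a) u) (plug (erase b) u)),
                    lie_context u a & lie_context u b]
  end.

Lemma erase_nsubst (X Y : Type) (f : X -> nterm Y) t :
  erase (nsubst f t) = wsubst (fun x => erase (f x)) (erase t).
Proof.
by elim: t => //= [t ->|a -> b ->]; rewrite ?wsubst_wcat.
Qed.

Lemma erase_nlift (t : nterm Z) : erase (nlift t) = wlift (erase t).
Proof. exact: erase_nsubst. Qed.

Lemma erase_nplug (T : nterm (option Z)) t : erase (nplug T t) = plug (erase T) (erase t).
Proof. by rewrite erase_nsubst; apply: eq_wsubst; case. Qed.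

Lemma erase_nplug_star (T : nterm (option Z)) M :
  erase (nplug_star T M) = plug_star (erase T) (erase M).
Proof. by rewrite erase_nsubst; apply: eq_wsubst; case. Qed.

Lemma nplug_nlift (t : nterm Z) a : nplug (nlift t) a = t.
Proof. by elim: t => //= [t IH|b IHb c IHc]; rewrite /nplug /= ?[nsubst _ _]IH ?[nsubst _ (nsubst _ b)]IHb ?[nsubst _ (nsubst _ c)]IHc. Qed.

Lemma lie_context_nlift u t : nls le t -> lie_context u (nlift t).
Proof.
elim: t => //= a IHa b IHb [ab na nb _]; split; [|exact: IHa|exact: IHb].
by rewrite -/(nlift a) -/(nlift b) !erase_nlift !plug_wlift.
Qed.

(** Exchanging a subterm for one with the same word leaves the words of all surrounding commutators
    unchanged. *)
Lemma lie_context_nplug_star u t T M :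
  nls le (nplug T t) -> erase t = plug (erase M) u -> lie_context u M ->
  lie_context u (nplug_star T M).
Proof.
move=> nt et lM; elim: T nt => [[z|]|T IH|a IHa b IHb] //=.
case=> ab na nb _; split; [|exact: IHa|exact: IHb].
rewrite -/(nplug_star a M) -/(nplug_star b M) !erase_nplug_star !plug_comp -et.
by rewrite -!erase_nplug.
Qed.

Definition lie_chain (cs : seq (word Z)) : nterm (option Z) :=
  foldl (fun a c => NBin a (nlift (lsb le c))) (NGen None) cs.

Lemma erase_lie_chain cs : (forall c, c \in cs -> alsbw le c) ->
  erase (lie_chain cs) = foldl (@wcat _) star (map (@wlift Z) cs).
Proof.
elim/last_ind: cs => //= cs c IH H.
rewrite /lie_chain map_rcons !foldl_rcons /= erase_nlift -/(lie_chain cs) IH.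
  by rewrite (proj1 (lsbP (H c _))) // mem_rcons mem_head.
by move=> d dc; apply: H; rewrite mem_rcons inE dc orbT.
Qed.

Lemma plug_chain u cs :
  plug (foldl (@wcat _) star (map (@wlift Z) cs)) u = foldl (@wcat _) u cs.
Proof.
elim/last_ind: cs => //= cs c IH.
by rewrite map_rcons !foldl_rcons plug_wcat plug_wlift IH.
Qed.

Lemma lie_context_chain u cs :
  alsbw le u -> alsbw le (foldl (@wcat _) u cs) -> (forall c, c \in cs -> alsbw le c) ->
  sorted (fun c d => wlexge le d c) cs -> lie_context u (lie_chain cs).
Proof.
move=> /alsbw_lyndon lu /alsbw_lyndon; rewrite letters_chain => lw acs scs.
have lcs c : c \in map (@letters Z) cs -> lyndon c.
  by case/mapP=> d /acs/alsbw_lyndon ld ->.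
have scs': sorted (fun c d => lexse d c) (map (@letters Z) cs).
  by rewrite sorted_map; apply: sub_sorted scs => c d /=; rewrite wlexgeE.
have chain := lyndon_chain lu lw lcs scs'.
suff H cs1 cs2 : cs = cs1 ++ cs2 -> lie_context u (lie_chain cs1).
  by apply: (H cs [::]); rewrite cats0.
elim/last_ind: cs1 cs2 => //= cs1 c IH cs2 def_cs.
have def_cs': cs = cs1 ++ c :: cs2 by rewrite def_cs -cats1 -catA.
have ac: alsbw le c by apply: acs; rewrite def_cs' mem_cat mem_head orbT.
have acs1 d : d \in cs1 -> alsbw le d by move=> dc; apply: acs; rewrite def_cs' mem_cat dc.
rewrite /lie_chain foldl_rcons /= -/(lie_chain cs1); split.
2: exact: (IH _ def_cs').
2: by apply: lie_context_nlift; case: (lsbP ac).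
rewrite erase_lie_chain // plug_chain erase_nlift plug_wlift (proj1 (lsbP ac)).
apply/alswP; rewrite letters_wcat letters_chain -catA.
have := chain (map (@letters Z) (rcons cs1 c)) (map (@letters Z) cs2).
by rewrite -map_cat -def_cs map_rcons flatten_rcons; apply.
Qed.

Lemma plug_Last q u p : starred q -> plug q u = Last p ->
  (q = star /\ u = Last p) \/
  exists q', [/\ starred q', q = brk q' & p = Brk (plug q' u)].
Proof.
move=> /starred_ctx[s [a [t [-> ha]]]] /(congr1 (@letters _)).
rewrite letters_plug_ctx; case: s => [|? [|? ?]] /=; last by [].
  case: t => [|? ?] /=; last first.
    case: (letters _) (@letters_nil _ (lplug a u)) => [/(_ erefl)//|? [|? ?]] //.
  rewrite cats0 => e; case: ha e => [->|[q' sq' ->]] /=.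
    by move/size_letters1; left.
  by case=> <-; right; exists q'.
by case: (letters _) (@letters_nil _ (lplug a u)) => [/(_ erefl)|].
Qed.

(** Descent along [t]: the occurrence of [u] stays within one factor until it is the whole subterm
    or meets both factors, and in the latter case it must be an initial segment. The letters after
    it give [cs] by Lyndon factorization. *)
Lemma special_bracketing_nls t q u :
  nls le t -> starred q -> alsbw le u -> erase t = plug q u ->
  exists (T : nterm (option Z)) (cs : seq (word Z)),
    [/\ q = plug_star (erase T) (foldl (@wcat _) star (map (@wlift Z) cs)),
        alsbw le (foldl (@wcat _) u cs),
        t = nplug T (lsb le (foldl (@wcat _) u cs)) &
        (forall c, c \in cs -> alsbw le c) /\ sorted (fun c d => wlexge le d c) cs].
Proof.
move=> nt sq au; elim: t q nt sq => [z|t IH|a IHa b IHb] q nt sq e.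
- have [[-> def_u]|[q' [_ _ //]]] := plug_Last sq (esym e).
  exists (NGen None), [::]; split=> //.
  by rewrite /nplug /= def_u -[Last _]/(erase (NGen z)) lsb_erase.
- have [[-> def_u]|[q' [sq' -> [e']]]] := plug_Last sq (esym e).
    exists (NGen None), [::]; split=> //.
    by rewrite /nplug /= def_u -[Last _]/(erase (NBrk t)) lsb_erase.
  have [T [cs [def_q' auc def_t [acs scs]]]] := IH q' nt sq' e'.
  exists (NBrk T), cs; split=> //; first by rewrite def_q'.
  by rewrite {1}def_t.
have [_ na nb cond] := nt.
have [[q' [sq' e' def_q]]|[q' [sq' e' def_q]]|[x [a2 [b1 [y]]]]] := plug_wcat_split sq (esym e).
- have [T [cs [def_q' auc def_a [acs scs]]]] := IHa q' na sq' (esym e').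
  exists (NBin T (nlift b)), cs; split=> //.
    by rewrite /= plug_star_wcat erase_nlift plug_star_wlift -def_q'.
  by rewrite /nplug /= -/(nplug T _) -def_a -/(nplug (nlift b) _) nplug_nlift.
- have [T [cs [def_q' auc def_b [acs scs]]]] := IHb q' nb sq' (esym e').
  exists (NBin (nlift a) T), cs; split=> //.
    by rewrite /= plug_star_wcat erase_nlift plug_star_wlift -def_q'.
  by rewrite /nplug /= -/(nplug T _) -def_b -/(nplug (nlift a) _) nplug_nlift.
move=> [ea eb [na2 nb1] eu def_q].
(* Otherwise $a_2 b$ is a proper suffix, so $b \le a_2 b$ and then $b \le a_2$; but $u = a_2 b_1$ is
   Lyndon, so $a_2 \le u < b_1 \le b$. *)
have x0: x = [::].
  case: (eqVneq x [::]) => // nx.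
  have b_a2: lexse (letters (erase b)) a2.
    apply: (lexse_suffix_cat irr tr tot (nls_lyndon nb) na2).
    apply: (nls_min nt nx); first by case: (a2) na2.
    by rewrite ea catA.
  have [_ /(_ _ _ na2 nb1 eu)] := alsbw_lyndon au; rewrite eu => lt1.
  have := lexse_lt_trans tr (lexse_catr irr a2 b1) lt1.
  move=> /(lexs_le_trans tr)/(_ (lexse_catr irr b1 y)); rewrite -eb.
  by move=> /(lexs_le_trans tr)/(_ b_a2); rewrite lexs_irr.
have et: letters (erase (NBin a b)) = letters u ++ y.
  by rewrite /= letters_wcat ea eb eu x0 catA.
have at_ := nls_alsbw nt.
have [cs [def_y acs scs]]: exists cs : seq (word Z),
   [/\ y = flatten (map (@letters Z) cs), forall c, c \in cs -> alsbw le c &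
       sorted (fun c d => wlexge le d c) cs].
  have [->|ny] := eqVneq y [::]; first by exists [::].
  have [ds [nds def_y lds sds]] := lyndon_factorization irr tr tot ny.
  have [cs def_ds]: exists cs, map (@letters Z) cs = ds.
    elim: ds lds {nds def_y sds} => [|d ds IHd] lds; first by exists [::].
    have [|cs <-] := IHd; first by move=> c cds; apply: lds; rewrite inE cds orbT.
    have [nd _] := lds d (mem_head _ _).
    have [|c <-] := @letters_surj _ d; first by case: (d) nd.
    by exists (c :: cs).
  exists cs; rewrite def_ds; split=> //.
    move=> c cin; apply: (alsbw_sub at_).
      by apply: lds; rewrite -def_ds; apply: map_f.
    move=> p pc; rewrite et mem_cat def_y -def_ds; apply/orP; right.
    by apply/flattenP; exists (letters c); first exact: map_f.
  by move: sds; rewrite -def_ds sorted_map; apply: sub_sorted => c d /=; rewrite wlexgeE.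
have euc: foldl (@wcat _) u cs = erase (NBin a b).
  by apply: letters_inj; rewrite letters_chain -def_y et.
exists (NGen None), cs; rewrite euc; split=> //.
  apply: letters_inj; rewrite def_q letters_ctx x0 /= letters_chain.
  by rewrite /= def_y map_flatten -!map_comp; congr (_ :: flatten _); apply: eq_map => c /=; rewrite letters_wlift.
by rewrite lsb_erase.
Qed.

(** Both properties hold for every witness of [special_bracketing], so the choice made by [epsilon]
    is immaterial here. *)
Lemma specialP q u : starred q -> alsbw le u -> alsbw le (plug q u) ->
  erase (special le q u) = q /\ lie_context u (special le q u).
Proof.
move=> sq au aq; have [elsb nlsb] := lsbP aq.
have [T [cs [def_q auc def_T [acs scs]]]] := special_bracketing_nls nlsb sq au elsb.
have: exists M, special_bracketing le q u M.
  by exists (nplug_star T (lie_chain cs)), T, cs.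
move/(epsilon_spec (inhabits (NGen None))); rewrite -/(special le q u).
move=> {T cs def_q auc def_T acs scs} [T [cs [def_q auc def_T [acs scs] ->]]].
have [euc nuc] := lsbP auc.
split; first by rewrite erase_nplug_star erase_lie_chain.
apply: (lie_context_nplug_star (t := lsb le (foldl (@wcat _) u cs)) _ _
         (lie_context_chain au auc acs scs)).
  by rewrite -def_T.
by rewrite erase_lie_chain // plug_chain.
Qed.

End MonomialOrder.

Local Open Scope ring_scope.

(** * Linear combinations and linear maps *)

Section LinearCombinations.
Context (k : fieldType) (E : lmodType k).
Implicit Types (P Q : E -> Prop) (x y : E).

Lemma lincomb0 P : lincomb P 0.
Proof. by exists [::]; split=> //; rewrite big_nil. Qed.

Lemma lincombD P x y : lincomb P x -> lincomb P y -> lincomb P (x + y).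
Proof.
move=> [l [Hl ->]] [l' [Hl' ->]]; exists (l ++ l'); split; last by rewrite big_cat.
by move=> z; rewrite mem_cat => /orP[/Hl|/Hl'].
Qed.

Lemma lincombZ P a x : lincomb P x -> lincomb P (a *: x).
Proof.
move=> [l [Hl ->]]; exists [seq (a * z.1, z.2) | z <- l]; split.
  by move=> z /mapP[z' /Hl Hz ->].
by rewrite big_map scaler_sumr; apply: eq_bigr => z _; rewrite scalerA.
Qed.

Lemma lincomb_gen P x : P x -> lincomb P x.
Proof.
move=> Px; exists [:: (1, x)]; split; first by move=> z; rewrite inE => /eqP->.
by rewrite big_seq1 scale1r.
Qed.

Lemma lincombN P x : lincomb P x -> lincomb P (- x).
Proof. by rewrite -scaleN1r; apply: lincombZ. Qed.

Lemma lincombB P x y : lincomb P x -> lincomb P y -> lincomb P (x - y).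
Proof. by move=> Px Py; apply: lincombD Px (lincombN Py). Qed.

Lemma lincomb_ind P (C : E -> Prop) :
  C 0 -> (forall x y, C x -> C y -> C (x + y)) -> (forall a x, C x -> C (a *: x)) ->
  (forall x, P x -> C x) -> forall x, lincomb P x -> C x.
Proof.
move=> C0 CD CZ CP _ [l [Hl ->]]; rewrite big_seq; apply: big_ind => // z /Hl Pz.
exact/CZ/CP.
Qed.

End LinearCombinations.

Definition linear_map (k : fieldType) (E F : lmodType k) (h : E -> F) : Prop :=
  forall a x y, h (a *: x + y) = a *: h x + h y.

Section LinearMaps.
Context (k : fieldType) (E F : lmodType k) (h : E -> F).
Hypothesis lh : linear_map h.

Lemma linear_map0 : h 0 = 0.
Proof. by have := lh (-1) 0 0; rewrite scaler0 addr0 scaleN1r addNr. Qed.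

Lemma linear_mapD x y : h (x + y) = h x + h y.
Proof. by rewrite -[x]scale1r lh !scale1r. Qed.

Lemma linear_mapZ a x : h (a *: x) = a *: h x.
Proof. by rewrite -[a *: x]addr0 lh linear_map0 addr0. Qed.

Lemma linear_mapB x y : h (x - y) = h x - h y.
Proof. by rewrite linear_mapD -scaleN1r linear_mapZ scaleN1r. Qed.

Lemma linear_map_sum (I : Type) (r : seq I) (f : I -> E) :
  h (\sum_(i <- r) f i) = \sum_(i <- r) h (f i).
Proof. by elim/big_rec2: _ => [|i y1 y2 _ <-]; rewrite ?linear_map0 ?linear_mapD. Qed.

Lemma lincomb_image P Q : (forall x, P x -> lincomb Q (h x)) ->
  forall x, lincomb P x -> lincomb Q (h x).
Proof.
move=> H; apply: lincomb_ind => //.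
- by rewrite linear_map0; apply: lincomb0.
- by move=> x y Qx Qy; rewrite linear_mapD; apply: lincombD.
- by move=> a x Qx; rewrite linear_mapZ; apply: lincombZ.
Qed.

End LinearMaps.

Lemma lincomb_bind (k : fieldType) (E : lmodType k) (P Q : E -> Prop) :
  (forall x, P x -> lincomb Q x) -> forall x, lincomb P x -> lincomb Q x.
Proof. by move=> H; apply: (lincomb_image (h := id)). Qed.

Lemma lincombW (k : fieldType) (E : lmodType k) (P Q : E -> Prop) :
  (forall x, P x -> Q x) -> forall x, lincomb P x -> lincomb Q x.
Proof. by move=> H; apply: lincomb_bind => x /H; apply: lincomb_gen. Qed.

(** * The semigroup algebra and leading words of bracketings *)

Section FreeModule.
Context (k : fieldType) (K : choiceType).
Implicit Types (f : {malg k[K]}) (u v : K).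

Lemma malg_scaleU (a : k) u : a *: << u >> = << a *g u >> :> {malg k[K]}.
Proof. by apply/malgP => v; rewrite mcoeffZ !mcoeffU mulrnAr mulr1. Qed.

Lemma malg_sum f : f = \sum_(u <- msupp f) f@_u *: << u >>.
Proof. by rewrite {1}[f]monalgE; apply: eq_bigr => u _; rewrite malg_scaleU. Qed.

Lemma msupp_basis u : msupp (<< u >> : {malg k[K]}) = [fset u]%fset.
Proof. by rewrite msuppU oner_eq0. Qed.

Lemma mcoeff_basis u v : (<< u >> : {malg k[K]})@_v = (u == v)%:R.
Proof. by rewrite mcoeffU. Qed.

End FreeModule.

Section SemigroupAlgebra.
Context (k : fieldType) (Z : choiceType).
Local Notation A := {malg k[word Z]}.
Implicit Types (f g s : A) (u v w : word Z) (q r : word (option Z)).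

Lemma linextEw (E : lmodType k) (F : word Z -> E) (d : {fset word Z}) f :
  (msupp f `<=` d)%fset -> linext F f = \sum_(u <- d) f@_u *: F u.
Proof.
move=> sub; rewrite /linext (big_fset_incl _ sub) // => u _ nu.
by rewrite mcoeff_outdom // scale0r.
Qed.

Lemma linext_linear (E : lmodType k) (F : word Z -> E) : linear_map (linext F).
Proof.
move=> a f g; pose d := (msupp f `|` msupp g)%fset.
have sf: (msupp f `<=` d)%fset by apply: fsubsetUl.
have sg: (msupp g `<=` d)%fset by apply: fsubsetUr.
have sfg: (msupp (a *: f + g) `<=` d)%fset.
  apply: fsubset_trans (msuppD_le _ _) _; rewrite fsubUset sg andbT.
  exact: fsubset_trans (msuppZ_le _ _) sf.
rewrite (linextEw _ sf) (linextEw _ sg) (linextEw _ sfg) scaler_sumr -big_split /=.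
by apply: eq_bigr => u _; rewrite mcoeffD mcoeffZ scalerDl scalerA.
Qed.

Lemma linextU (E : lmodType k) (F : word Z -> E) u : linext F << u >> = F u.
Proof. by rewrite /linext msupp_basis big_seq_fset1 mcoeff_basis eqxx scale1r. Qed.

Lemma malg_ext (E : lmodType k) (h h' : A -> E) :
  linear_map h -> linear_map h' -> (forall u, h << u >> = h' << u >>) ->
  forall f, h f = h' f.
Proof.
move=> lh lh' e f; rewrite [f]malg_sum (linear_map_sum lh) (linear_map_sum lh').
by apply: eq_bigr => u _; rewrite (linear_mapZ lh) (linear_mapZ lh') e.
Qed.

Lemma aplug_linear q : linear_map (aplug q : A -> A).
Proof. exact: linext_linear. Qed.

Lemma abrk_linear : linear_map (@abrk k Z).
Proof. exact: linext_linear. Qed.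

Lemma amul_linear_r f : linear_map (amul f).
Proof.
move=> a g g'; rewrite /amul {1 3 5}/linext scaler_sumr -big_split.
by apply: eq_bigr => u _ /=; rewrite linext_linear scalerDr !scalerA mulrC.
Qed.

Lemma amul_linear_l g : linear_map (fun f => amul f g).
Proof. by move=> a f f'; rewrite /amul linext_linear. Qed.

Lemma amulB_split f f' g g' :
  amul f g - amul f' g' = amul (f - f') g + amul f' (g - g').
Proof.
rewrite (linear_mapB (amul_linear_l g)) (linear_mapB (amul_linear_r f')).
by rewrite addrA subrK.
Qed.

Lemma amulB_split' f f' g g' :
  amul f g - amul f' g' = amul f (g - g') + amul (f - f') g'.
Proof.
rewrite (linear_mapB (amul_linear_l g')) (linear_mapB (amul_linear_r f)).
by rewrite addrA subrK.
Qed.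

Lemma aplugU q u : aplug q << u >> = << plug q u >> :> A.
Proof. exact: linextU. Qed.

Lemma abrkU u : abrk << u >> = << brk u >> :> A.
Proof. exact: linextU. Qed.

Lemma amulU u v : amul << u >> << v >> = << wcat u v >> :> A.
Proof. by rewrite /amul !linextU. Qed.

Lemma linear_comp (h h' : A -> A) :
  linear_map h -> linear_map h' -> linear_map (h \o h').
Proof. by move=> lh lh' a x y /=; rewrite lh' lh. Qed.

Lemma linear_id : linear_map (@id A). Proof. by []. Qed.

Lemma aplug_star f : aplug star f = f.
Proof. by apply: malg_ext (aplug_linear _) linear_id _ f => u; rewrite aplugU. Qed.

Lemma aplug_comp q r f : aplug (plug_star q r) f = aplug q (aplug r f).
Proof.
apply: malg_ext (aplug_linear _) (linear_comp (aplug_linear q) (aplug_linear r)) _ f.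
by move=> u /=; rewrite !aplugU plug_comp.
Qed.

Lemma abrk_aplug q f : abrk (aplug q f) = aplug (brk q) f.
Proof.
apply: malg_ext (linear_comp abrk_linear (aplug_linear q)) (aplug_linear _) _ f.
by move=> u /=; rewrite !aplugU abrkU.
Qed.

Lemma amul_aplug_r q v f : amul (aplug q f) << v >> = aplug (wcat q (wlift v)) f.
Proof.
apply: malg_ext (linear_comp (amul_linear_l _) (aplug_linear q)) (aplug_linear _) _ f.
by move=> u /=; rewrite !aplugU amulU plug_wcat plug_wlift.
Qed.

Lemma amul_aplug_l q v f : amul << v >> (aplug q f) = aplug (wcat (wlift v) q) f.
Proof.
apply: malg_ext (linear_comp (amul_linear_r _) (aplug_linear q)) (aplug_linear _) _ f.
by move=> u /=; rewrite !aplugU amulU plug_wcat plug_wlift.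
Qed.

Definition wspan (P : word Z -> Prop) : A -> Prop :=
  lincomb (fun x => exists2 u, P u & x = << u >>).

(** Here [u] stands for the leading word of [s]. Unlike [wspan], this records membership in the
    ideal of [s] along with a bound on the words $q|_u$. *)
Definition sspan u s (P : word Z -> Prop) : A -> Prop :=
  lincomb (fun x => exists q, [/\ starred q, P (plug q u) & x = aplug q s]).

Lemma sspanD u s P f g : sspan u s P f -> sspan u s P g -> sspan u s P (f + g).
Proof. exact: lincombD. Qed.

Lemma sspanB u s P f g : sspan u s P f -> sspan u s P g -> sspan u s P (f - g).
Proof. exact: lincombB. Qed.

Lemma wspanP P f : wspan P f <-> forall u, u \in msupp f -> P u.
Proof.
split=> [Pf|H]; last first.
  exists [seq (f@_u, << u >>) | u <- msupp f]; split; last by rewrite big_map -malg_sum.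
  by move=> x /mapP[u /H Pu ->]; exists u.
move: f Pf; apply: lincomb_ind.
- by move=> u; rewrite msupp0.
- move=> f g Hf Hg u /(fsubsetP (msuppD_le _ _)).
  by rewrite in_fsetU => /orP[/Hf|/Hg].
- by move=> a f Hf u /(fsubsetP (msuppZ_le _ _))/Hf.
- by move=> _ [u Pu ->] v; rewrite msupp_basis inE => /eqP->.
Qed.

Lemma wspanW (P Q : word Z -> Prop) f : (forall u, P u -> Q u) -> wspan P f -> wspan Q f.
Proof. by move=> PQ; apply: lincombW => _ [u /PQ Qu ->]; exists u. Qed.

Lemma sspanW u s (P Q : word Z -> Prop) f :
  (forall w, P w -> Q w) -> sspan u s P f -> sspan u s Q f.
Proof. by move=> PQ; apply: lincombW => _ [q [sq /PQ Qu ->]]; exists q. Qed.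

Lemma wspanU (P : word Z -> Prop) u : P u -> wspan P << u >>.
Proof. by move=> Pu; apply: lincomb_gen; exists u. Qed.

Lemma amul_wspan (P Q R : word Z -> Prop) f g :
  (forall u v, P u -> Q v -> R (wcat u v)) ->
  wspan P f -> wspan Q g -> wspan R (amul f g).
Proof.
move=> H Pf Qg; apply: (lincomb_image (amul_linear_l g)) Pf => _ [u Pu ->].
apply: (lincomb_image (amul_linear_r _)) Qg => _ [v Qv ->].
by rewrite amulU; apply/wspanU/H.
Qed.

Lemma amul_sspan_r (P Q R : word Z -> Prop) u s f g :
  (forall u v, P u -> Q v -> R (wcat u v)) ->
  sspan u s P f -> wspan Q g -> sspan u s R (amul f g).
Proof.
move=> H Pf Qg; apply: (lincomb_image (amul_linear_l g)) Pf => _ [q [sq Pu ->]].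
apply: (lincomb_image (amul_linear_r _)) Qg => _ [v Qv ->].
rewrite amul_aplug_r; apply: lincomb_gen; exists (wcat q (wlift v)).
by rewrite starred_wcatl // plug_wcat plug_wlift; split=> //; apply: H.
Qed.

Lemma amul_sspan_l (P Q R : word Z -> Prop) u s f g :
  (forall u v, Q v -> P u -> R (wcat v u)) ->
  sspan u s P f -> wspan Q g -> sspan u s R (amul g f).
Proof.
move=> H Pf Qg; apply: (lincomb_image (amul_linear_r g)) Pf => _ [q [sq Pu ->]].
apply: (lincomb_image (amul_linear_l _)) Qg => _ [v Qv ->].
rewrite amul_aplug_l; apply: lincomb_gen; exists (wcat (wlift v) q).
by rewrite starred_wcatr // plug_wcat plug_wlift; split=> //; apply: H.
Qed.

Lemma abrk_wspan (P R : word Z -> Prop) f :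
  (forall u, P u -> R (brk u)) -> wspan P f -> wspan R (abrk f).
Proof.
move=> H; apply: (lincomb_image abrk_linear) => _ [u Pu ->].
by rewrite abrkU; apply/wspanU/H.
Qed.

Lemma abrk_sspan (P R : word Z -> Prop) u s f :
  (forall u, P u -> R (brk u)) -> sspan u s P f -> sspan u s R (abrk f).
Proof.
move=> H; apply: (lincomb_image abrk_linear) => _ [q [sq Pu ->]].
by rewrite abrk_aplug; apply: lincomb_gen; exists (brk q); split=> //; apply: H.
Qed.

Lemma aplug_wspan (P R : word Z -> Prop) q f :
  (forall u, P u -> R (plug q u)) -> wspan P f -> wspan R (aplug q f).
Proof.
move=> H; apply: (lincomb_image (aplug_linear _)) => _ [u Pu ->].
by rewrite aplugU; apply/wspanU/H.
Qed.

Context (le : rel (word Z)).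
Hypothesis le_mono : monomial_order le.
Hypothesis le_inv : invariant_order le.

Definition below w : A -> Prop := wspan (fun u => wlt le u w).

(** Leading word and leading coefficient in one condition on the remainder; in this form it passes
    through contexts, brackets and commutators by linearity. *)
Definition monic_at w f : Prop := below w (f - << w >>).

Lemma monic_at_le w f : monic_at w f -> wspan (fun u => le u w) f.
Proof.
move=> fw; rewrite -[f](subrK << w >>); apply: lincombD.
  by apply: wspanW fw => u; apply: wltW.
by apply: wspanU; apply: mo_refl.
Qed.

Lemma below_coef w f u : below w f -> le w u -> f@_u = 0.
Proof.
move/wspanP => H wu; apply/eqP; rewrite mcoeff_eq0; apply/negP => /H uw.
by have := wlt_le_trans le_mono uw wu; rewrite wlt_irr.
Qed.

Lemma monic_at_coef w f : monic_at w f -> f@_w = 1.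
Proof.
move=> /below_coef/(_ (mo_refl le_mono w))/eqP.
by rewrite mcoeffB mcoeff_basis eqxx subr_eq0 => /eqP.
Qed.

Lemma monic_at_lead w f : monic_at w f -> is_lead le f w.
Proof.
move=> fw; split; first by rewrite -mcoeff_neq0 (monic_at_coef fw) oner_neq0.
by move=> u; apply/wspanP: u; apply: monic_at_le.
Qed.

Lemma is_lead_uniq f u v : is_lead le f u -> is_lead le f v -> u = v.
Proof.
by move=> [uf Hu] [vf Hv]; apply: (mo_anti le_mono); rewrite Hu // Hv.
Qed.

Lemma is_lead_below f w : is_lead le f w -> below w (f - f@_w *: << w >>).
Proof.
move=> [wf Hw]; apply/wspanP => u.
rewrite -mcoeff_neq0 mcoeffB mcoeffZ mcoeff_basis => ne.
have nuw: u != w by apply: contraNneq ne => ->; rewrite eqxx mulr1 subrr.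
rewrite /wlt nuw; apply: Hw.
by move: ne; rewrite [w == u]eq_sym (negPf nuw) mulr0 subr0 mcoeff_neq0.
Qed.

Lemma monic_lead f w : is_monic le f -> is_lead le f w -> monic_at w f.
Proof.
move=> [w' lw' f1] lw; rewrite (is_lead_uniq lw' lw) in f1.
by have := is_lead_below lw; rewrite f1 scale1r.
Qed.

Lemma lead_exists f : f != 0 -> exists w, is_lead le f w.
Proof.
have [e|[u0 u0f] _] := fset_0Vmem (msupp f).
  by rewrite [f]malg_sum e big_seq_fset0 eqxx.
suff H (l : seq (word Z)) : l != [::] -> exists2 w, w \in l & forall u, u \in l -> le u w.
  have [|w wf Hw] := H (msupp f); first by apply/eqP=> e; have := u0f : u0 \in enum_fset (msupp f); rewrite e.
  by exists w.
elim: l => // u l IH _; case: (eqVneq l [::]) => [->|/IH[w wl Hw]].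
  by exists u => [|v]; rewrite !inE // => /eqP->; apply: mo_refl.
have /orP[uw|wu] := mo_total le_mono u w.
  by exists w => [|v]; rewrite !inE ?wl ?orbT // => /orP[/eqP->|/Hw].
exists u => [|v]; rewrite !inE ?eqxx // => /orP[/eqP->|/Hw vw]; first exact: mo_refl.
exact: mo_trans vw wu.
Qed.

Lemma monic_at_aplug q u f : starred q -> monic_at u f -> monic_at (plug q u) (aplug q f).
Proof.
move=> sq fu; rewrite /monic_at -aplugU -(linear_mapB (aplug_linear q)).
by apply: aplug_wspan fu => v; apply: wlt_plug.
Qed.

(** Invariance of the order acts here: $uv$ and $vu$ have the same letters, so they compare
    lexicographically. *)
Lemma wlt_swap u v : alsw le (wcat u v) -> wlt le (wcat v u) (wcat u v).
Proof.
move=> /(_ _ _ erefl) gt; rewrite /wlt le_inv; last first.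
  by rewrite !letters_wcat perm_catC.
rewrite /wlexge /lexge; rewrite /wlexgt in gt; rewrite gt orbT andbT.
by apply: contraTneq gt => ->; rewrite lexgtE lexs_irr //; apply: rlt_irr.
Qed.

Lemma le_cat u u' v v' : le u u' -> le v v' -> le (wcat u v) (wcat u' v').
Proof.
rewrite [le v v'](le_eqVwlt le_mono) => uu /orP[/eqP <-|vv]; last first.
  exact/wltW/(wlt_cat' le_mono).
move: uu; rewrite (le_eqVwlt le_mono) => /orP[/eqP <-|uu]; first exact: mo_refl.
exact/wltW/(wlt_catl le_mono).
Qed.

Lemma acomm_lower u v x y :
  alsw le (wcat u v) -> le x u -> le y v -> wlt le (wcat y x) (wcat u v).
Proof.
move=> /wlt_swap sw xu yv; apply: le_wlt_trans le_mono _ _ _ _ sw.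
exact: le_cat.
Qed.

Lemma monic_at_acomm u v f g : alsw le (wcat u v) ->
  monic_at u f -> monic_at v g -> monic_at (wcat u v) (acomm f g).
Proof.
move=> uv fu gv; rewrite /monic_at /acomm addrAC; apply: lincombB; last first.
  apply: amul_wspan (monic_at_le gv) (monic_at_le fu) => v' u' vv uu.
  exact: (acomm_lower _ uu vv).
rewrite -amulU amulB_split; apply: lincombD.
  apply: amul_wspan fu (monic_at_le gv) => u' v' uu vv.
  exact: (wlt_cat le_mono).
apply: amul_wspan (wspanU (P := eq u) erefl) gv => _ v' <- vv.
exact: (wlt_catr le_mono).
Qed.

Lemma monic_at_brk u f : monic_at u f -> monic_at (brk u) (abrk f).
Proof.
move=> fu; rewrite /monic_at -abrkU -(linear_mapB abrk_linear).
by apply: abrk_wspan fu => v; apply: (wlt_brk le_mono).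
Qed.

Lemma nls_monic t : nls le t -> monic_at (erase t) (neval (@ngen k Z) t).
Proof.
elim: t => [z _|t IH nt|a IHa b IHb [ab na nb _]] /=.
- by rewrite /monic_at subrr; apply: lincomb0.
- exact/monic_at_brk/IH.
- by apply: monic_at_acomm ab _ _; [apply: IHa|apply: IHb].
Qed.

Lemma lsbw_monic w : alsbw le w -> monic_at w (lsbw k le w).
Proof.
move=> aw; have [e n] := lsbP le_mono aw.
by have := nls_monic n; rewrite e.
Qed.

Definition star_eval s (o : option Z) : A := if o is Some z then ngen k z else s.

Lemma lie_context_monic u s M : lie_context le u M -> nstars (erase M) = 0 ->
  monic_at (plug (erase M) u) (neval (star_eval s) M).
Proof.
elim: M => [[z|]|t IH|a IHa b IHb] /=.
- by rewrite /monic_at subrr => _ _; apply: lincomb0.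
- by [].
- by move=> /IH H /H; apply: monic_at_brk.
- case=> ab /IHa Ha /IHb Hb; rewrite nstars_wcat => /eqP.
  rewrite addn_eq0 => /andP[/eqP/Ha ? /eqP/Hb ?].
  by rewrite plug_wcat; apply: monic_at_acomm.
Qed.

Lemma sspan_le u s q f : starred q ->
  sspan u s (fun w => wlt le w (plug q u)) (f - aplug q s) ->
  sspan u s (fun w => le w (plug q u)) f.
Proof.
move=> sq H; rewrite -[f](subrK (aplug q s)); apply: lincombD.
  by apply: (sspanW (Q := fun w => le w (plug q u)) _ H) => w; apply: wltW.
by apply: lincomb_gen; exists q; split=> //; apply: mo_refl.
Qed.

(** At a commutator exactly one side contains the hole. The other side evaluates to a monic element:
    its leading word extends the context around [s], while its lower words and the swapped product
    give multiples of [s] with smaller words. *)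
Lemma lie_context_eval u s M : lie_context le u M -> starred (erase M) ->
  sspan u s (fun w => wlt le w (plug (erase M) u))
    (neval (star_eval s) M - aplug (erase M) s).
Proof.
elim: M => [[z|]|t IH|a IHa b IHb] /=.
- by [].
- by move=> _ _; rewrite -[gen None]/star aplug_star subrr; apply: lincomb0.
- move=> /IH H /H; rewrite -abrk_aplug -(linear_mapB abrk_linear).
  by apply: abrk_sspan => w; apply: (wlt_brk le_mono).
case=> ab la lb; rewrite /starred nstars_wcat plug_wcat.
case na: (nstars (erase a)) => [|n].
  rewrite add0n => sb.
  have Hb := IHb lb sb; have Ha := lie_context_monic s la na.
  have [wa def_a] := nstars0 na; rewrite def_a plug_wlift in ab Ha *.
  rewrite /acomm addrAC; apply: sspanB; last first.
    apply: amul_sspan_r (sspan_le sb Hb) (monic_at_le Ha) => v' u' vv uu.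
    exact: (acomm_lower _ uu vv).
  rewrite -amul_aplug_l amulB_split; apply: sspanD.
    apply: amul_sspan_l (sspan_le sb Hb) Ha => v' u' vv uu.
    exact: (wlt_cat le_mono).
  apply: amul_sspan_l Hb (wspanU (P := eq wa) erefl) => u' _ <- uu.
  exact: (wlt_catr le_mono).
rewrite addSn eqSS addn_eq0 => /andP[/eqP n0 /eqP nb].
have sa: starred (erase a) by rewrite /starred na n0.
have Ha := IHa la sa; have Hb := lie_context_monic s lb nb.
have [wb def_b] := nstars0 nb; rewrite def_b plug_wlift in ab Hb *.
rewrite /acomm addrAC; apply: sspanB; last first.
  apply: amul_sspan_l (sspan_le sa Ha) (monic_at_le Hb) => v' u' vv uu.
  exact: (acomm_lower _ uu vv).
rewrite -amul_aplug_r amulB_split'; apply: sspanD.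
  apply: amul_sspan_r (sspan_le sa Ha) Hb => v' u' vv uu.
  exact: (wlt_cat' le_mono).
apply: amul_sspan_r Ha (wspanU (P := eq wb) erefl) => u' _ uu <-.
exact: (wlt_catl le_mono).
Qed.

Lemma snw_aplug q s u : starred q -> alsbw le u -> alsbw le (plug q u) ->
  sspan u s (fun w => wlt le w (plug q u)) (snw le q s u - aplug q s).
Proof.
move=> sq au aq; have [e lM] := specialP le_mono sq au aq.
have := @lie_context_eval u s _ lM; rewrite e; exact.
Qed.

Lemma sspan_below u s w f : monic_at u s ->
  sspan u s (fun v => wlt le v w) f -> below w f.
Proof.
move=> su; apply: lincomb_bind => _ [q [sq qw ->]].
apply: wspanW (monic_at_le (monic_at_aplug sq su)) => v vq.
exact: le_wlt_trans qw.
Qed.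

Lemma snw_monic q s u : starred q -> alsbw le u -> alsbw le (plug q u) ->
  monic_at u s -> monic_at (plug q u) (snw le q s u).
Proof.
move=> sq au aq su; rewrite /monic_at -[snw _ _ _ _](subrK (aplug q s)) -addrA.
apply: lincombD; last exact: monic_at_aplug.
exact: sspan_below su (snw_aplug s sq au aq).
Qed.

Lemma neval_OLie (X : Type) (e : X -> A) t :
  (forall x, OLie (e x)) -> OLie (neval e t).
Proof.
move=> He; elim: t => //= [t|a Ha b Hb]; first exact: OLie_brk.
exact: OLie_comm.
Qed.

Lemma snw_OLie q s u : OLie s -> OLie (snw le q s u).
Proof. by move=> Os; apply: neval_OLie; case=> // z; apply: OLie_gen. Qed.

Lemma lsbw_OLie w : OLie (lsbw k le w).
Proof. by apply: neval_OLie => z; apply: OLie_gen. Qed.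

End SemigroupAlgebra.

(** * Straightening: Lyndon-Shirshov bracketings span the Lie algebra *)

Lemma jacobi_associative (V : zmodType) (m : V -> V -> V) (c := fun x y => m x y - m y x) :
  (forall x y z, m (x - y) z = m x z - m y z) ->
  (forall x y z, m x (y - z) = m x y - m x z) ->
  associative m -> forall x y z, c (c x y) z = c (c x z) y + c x (c y z).
Proof.
move=> mBl mBr mA x y z; rewrite /c !(mBl, mBr) !mA.
rewrite !opprB [RHS]addrACA [m (m x z) y - _ + _]addrC subrKA.
by rewrite [m (m y z) x - _ + _]addrC subrKA addrACA [RHS]addrACA [- _ - m (m z x) y]addrC.
Qed.

Section LieSpan.
Context (k : fieldType) (Z : choiceType).
Local Notation A := {malg k[word Z]}.
Implicit Types (f g s x y z : A) (u v w : word Z).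

Lemma amulA f g s : amul f (amul g s) = amul (amul f g) s.
Proof.
apply: malg_ext (amul_linear_l _) (linear_comp (amul_linear_l s) (amul_linear_l g)) _ f.
move=> u /=.
apply: malg_ext (linear_comp (amul_linear_r _) (amul_linear_l s))
  (linear_comp (amul_linear_l s) (amul_linear_r _)) _ g => v /=.
apply: malg_ext (linear_comp (amul_linear_r _) (amul_linear_r _)) (amul_linear_r _) _ s.
move=> w /=; rewrite (amulU _ v w) (amulU _ u v).
by rewrite (amulU _ u (wcat v w)) (amulU _ (wcat u v) w) wcatA.
Qed.

Lemma acomm_linear_l g : linear_map (fun f => acomm f g).
Proof.
move=> a f f'; rewrite /acomm (amul_linear_l g) (amul_linear_r g).
by rewrite scalerBr opprD addrACA.
Qed.

Lemma acomm_linear_r f : linear_map (acomm f).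
Proof.
move=> a g g'; rewrite /acomm (amul_linear_l f) (amul_linear_r f).
by rewrite scalerBr opprD addrACA.
Qed.

Lemma acommC f g : acomm f g = - acomm g f.
Proof. by rewrite /acomm opprB. Qed.

Lemma amulBl f g s : amul (f - g) s = amul f s - amul g s.
Proof. exact: (linear_mapB (amul_linear_l s)). Qed.

Lemma amulBr f g s : amul f (g - s) = amul f g - amul f s.
Proof. exact: (linear_mapB (amul_linear_r f)). Qed.

Lemma acomm_jacobi x y z :
  acomm (acomm x y) z = acomm (acomm x z) y + acomm x (acomm y z).
Proof.
exact: jacobi_associative amulBl amulBr amulA x y z.
Qed.

Lemma OLie_lsbw_brk (le : rel (word Z)) (le_mono : monomial_order le) w :
  alsbw le w -> alsbw le (brk w) /\ abrk (lsbw k le w) = lsbw k le (brk w).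
Proof.
move=> aw; have [e n] := lsbP le_mono aw.
have nb: nls le (NBrk (lsb le w)) by [].
have eb: erase (NBrk (lsb le w)) = brk w by rewrite /= e.
split; first by rewrite -eb; apply: nls_alsbw.
by rewrite /lsbw -eb lsb_erase.
Qed.

Context (le : rel (word Z)).
Hypothesis le_mono : monomial_order le.
Local Notation lexs := (lexs (rlt le)).
Local Notation ev := (neval (@ngen k Z)).
Local Notation lt t := (letters (erase t)).

(** The bounds on length and letters keep the straightening inside a range where [lexs] is
    well-founded; the bound by [r] lets a second commutator be straightened by induction. *)
Definition nls_span (s : seq (letter Z)) n (r : seq (letter Z)) : A -> Prop :=
  lincomb (fun x => exists c, [/\ nls le c, (size (lt c) <= n)%N,
    {subset lt c <= s}, lexs (lt c) r & x = ev c]).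

Let irr := rlt_irr le.
Let tr := rlt_trans le_mono.
Let tot := rlt_total le_mono.

Lemma size_lt_gt0 (t : nterm Z) : (0 < size (lt t))%N.
Proof. exact: size_letters_gt0. Qed.

(** Either $(a b)$ is already Lyndon-Shirshov, with word $ab < b$, or $a = (a_1 a_2)$ with $a_2 <
    b$, and Jacobi gives $[[a_1 b] a_2] + [a_1 [a_2 b]]$. The inner commutators are shorter and
    expand into words less than $b$, so the outer ones fall under the induction on [r]. *)
Lemma acomm_nls_span (s : seq (letter Z)) n r a b :
  (size r <= n)%N -> {subset r <= s} ->
  nls le a -> nls le b -> lt b = r -> {subset lt a <= s} ->
  (size (lt a) + size (lt b) <= n)%N -> lexs (lt a) (lt b) ->
  nls_span s (size (lt a) + size (lt b)) r (acomm (ev a) (ev b)).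
Proof.
elim: n r a b => [|n IHn] r a b.
  by move=> _ _ _ _ _ _; have := size_lt_gt0 a; case: (size _).
move=> sr ss; move: r sr ss a b.
apply: (lexs_bounded_ind irr tr) => r sr rs IHr a b na nb def_r as_ le_n ab.
(* Both words are less than [r], so the larger one can take the role of [r]; antisymmetry moves it
   to the right. *)
have sym p q m : nls le p -> nls le q -> {subset lt p <= s} -> {subset lt q <= s} ->
    (size (lt p) + size (lt q) <= m)%N -> (m <= n.+1)%N -> lexs (lt p) r -> lexs (lt q) r ->
    nls_span s m r (acomm (ev p) (ev q)).
  move=> np nq ps qs le_m le_mn pr qr.
  have weak x m' r' : (m' <= m)%N -> lexs r' r -> nls_span s m' r' x -> nls_span s m r x.
    move=> m'm r'r; apply: lincombW => _ [c [nc c1 c2 c3 ->]]; exists c; split=> //.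
      exact: leq_trans m'm.
    exact: (lexs_trans tr) c3 r'r.
  have /or3P[pq|/eqP pq|qp] := lexs_total irr tot (lt p) (lt q).
  - apply: (weak _ (size (lt p) + size (lt q))%N (lt q)) => //.
    have szm := leq_trans le_m le_mn.
    by apply: IHr => //; apply: leq_trans szm; apply: leq_addl.
  - rewrite (nls_uniq le_mono np nq (letters_inj pq)) /acomm subrr; exact: lincomb0.
  - rewrite acommC; apply: lincombN; rewrite addnC in le_m.
    apply: (weak _ (size (lt q) + size (lt p))%N (lt p)) => //.
    have szm := leq_trans le_m le_mn.
    by apply: IHr => //; apply: leq_trans szm; apply: leq_addl.
have la := nls_lyndon le_mono na; have lb := nls_lyndon le_mono nb.
have [nls_ab|[a1 [a2 [def_a a2b]]]]:
    nls le (NBin a b) \/ exists a1 a2, a = NBin a1 a2 /\ lexs (lt a2) (lt b).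
  have lab: alsw le (erase (NBin a b)).
    by apply/(alswP le_mono); rewrite /= letters_wcat; apply: (lyndon_cat irr tr).
  case: (a) na lab => [z|t|a1 a2] na lab; try by left.
  have [ba2|] := boolP (wlexge le (erase b) (erase a2)); first by left.
  rewrite wlexgeE (lexseNgt irr tr tot) negbK => a2b.
  by right; exists a1, a2.
- apply: lincomb_gen; exists (NBin a b); rewrite /= letters_wcat size_cat; split=> //.
    by move=> p; rewrite mem_cat => /orP[/as_|]; rewrite ?def_r // => /rs.
  by rewrite -def_r; apply: (lyndon_prefix_lt irr) => //; case: la.
have [_ na1 na2 _]: nls le (NBin a1 a2) by rewrite -def_a.
have def_lt_a: lt a = lt a1 ++ lt a2 by rewrite def_a /= letters_wcat.
have a1s: {subset lt a1 <= s} by move=> p pa; apply: as_; rewrite def_lt_a mem_cat pa.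
have a2s: {subset lt a2 <= s} by move=> p pa; apply: as_; rewrite def_lt_a mem_cat pa orbT.
have a1b: lexs (lt a1) (lt b).
  by apply: (lexs_trans tr) ab; rewrite def_lt_a (lexs_catr irr) // -size_eq0 -lt0n size_lt_gt0.
have szb: (size (lt b) <= n)%N.
  by rewrite -ltnS; apply: leq_trans le_n; rewrite -add1n leq_add2r size_lt_gt0.
have bs: {subset lt b <= s} by rewrite def_r.
have sz_a: (size (lt a) = size (lt a1) + size (lt a2))%N by rewrite def_lt_a size_cat.
have -> : ev a = acomm (ev a1) (ev a2) by rewrite def_a.
rewrite acomm_jacobi; apply: lincombD.
  have := IHn (lt b) a1 b szb bs na1 nb erefl a1s.
  have le1: (size (lt a1) + size (lt b) <= n)%N.
    rewrite -ltnS; apply: leq_trans le_n; rewrite ltn_add2r sz_a.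
    by rewrite -addn1 leq_add2l size_lt_gt0.
  move=> /(_ le1 a1b); apply: (lincomb_image (acomm_linear_l _)).
  move=> _ [c [nc c1 c2 c3 ->]]; apply: sym => //; rewrite -?def_r //.
  by rewrite sz_a addnAC leq_add2r.
have := IHn (lt b) a2 b szb bs na2 nb erefl a2s.
have le2: (size (lt a2) + size (lt b) <= n)%N.
  rewrite -ltnS; apply: leq_trans le_n; rewrite ltn_add2r sz_a.
  by rewrite -add1n leq_add2r size_lt_gt0.
move=> /(_ le2 a2b); apply: (lincomb_image (acomm_linear_r _)).
move=> _ [c [nc c1 c2 c3 ->]]; apply: sym => //; rewrite -?def_r //.
by rewrite sz_a -addnA leq_add2l.
Qed.

Lemma nls_NLSBW t : nls le t -> NLSBW le (ev t).
Proof.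
move=> nt; exists (erase t); first exact: nls_alsbw.
by rewrite /lsbw lsb_erase.
Qed.

Lemma acomm_NLSBW x y : NLSBW le x -> NLSBW le y -> lincomb (NLSBW le) (acomm x y).
Proof.
move=> [u au ->] [v av ->]; rewrite /lsbw.
have [_ nu] := lsbP le_mono au; have [_ nv] := lsbP le_mono av.
move: (lsb le u) (lsb le v) nu nv => a b na nb {u v au av}.
have H p q : nls le p -> nls le q -> lexs (lt p) (lt q) ->
    lincomb (NLSBW le) (acomm (ev p) (ev q)).
  move=> np nq pq.
  have sp: {subset lt p <= lt p ++ lt q} by move=> c cp; rewrite mem_cat cp.
  have sq: {subset lt q <= lt p ++ lt q} by move=> c cq; rewrite mem_cat cq orbT.
  have := acomm_nls_span (leq_addl (size (lt p)) _) sq np nq erefl sp (leqnn _) pq.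
  by apply: lincombW => _ [t [nt _ _ _ ->]]; apply: nls_NLSBW.
have /or3P[ab|/eqP ab|ba] := lexs_total irr tot (lt a) (lt b).
- exact: H.
- rewrite (nls_uniq le_mono na nb (letters_inj ab)) /acomm subrr; exact: lincomb0.
- rewrite acommC; apply: lincombN; exact: H.
Qed.

Lemma OLie_NLSBW f : OLie f <-> lincomb (NLSBW le) f.
Proof.
split; last first.
  apply: lincomb_ind; [exact: OLie_zero|exact: OLie_add|exact: OLie_scale|].
  by move=> _ [w _ ->]; apply: lsbw_OLie.
elim=> {f}.
- by move=> z; apply: lincomb_gen; apply: (nls_NLSBW (t := NGen z)).
- exact: lincomb0.
- by move=> f g _ Hf _ Hg; apply: lincombD.
- by move=> a f _ Hf; apply: lincombZ.
- move=> f g _ Hf _ Hg; apply: (lincomb_image (acomm_linear_l g)) Hf => x Nx.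
  by apply: (lincomb_image (acomm_linear_r x)) Hg => y Ny; apply: acomm_NLSBW.
- move=> f _; apply: (lincomb_image (@abrk_linear k Z)) => _ [w aw ->].
  have [abw ->] := OLie_lsbw_brk le_mono aw.
  by apply: lincomb_gen; exists (brk w).
Qed.

End LieSpan.

(** * Rewriting systems that are triangular for a monomial order *)

Section TriangularRewriting.
Context (k : fieldType) (Z : choiceType) (le : rel (word Z)).
Hypothesis le_mono : monomial_order le.
Local Notation A := {malg k[word Z]}.
Local Notation below := (@below k Z le).
Implicit Types (c d f g h r : A) (u v w p : word Z).

(** A rewriting step seen on coordinates: any word of the support, not only the leading one, gives
    way to smaller words. *)
Definition coef_step c c' : Prop :=
  exists p g, [/\ c@_p != 0, below p g & c' = c - c@_p *: (<< p >> - g)].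

Local Notation step_acc := (Acc (fun c' c => coef_step c c')).

Lemma belowD w f g : below w f -> below w g -> below w (f + g).
Proof. exact: lincombD. Qed.

Lemma belowB w f g : below w f -> below w g -> below w (f - g).
Proof. exact: lincombB. Qed.

Lemma belowZ w a f : below w f -> below w (a *: f).
Proof. exact: lincombZ. Qed.

Lemma belowW u v f : le u v -> below u f -> below v f.
Proof. by move=> uv; apply: wspanW => w wu; apply: wlt_le_trans wu uv. Qed.

Lemma below_basis u v : wlt le u v -> below v << u >>.
Proof. by move=> uv; apply: wspanU. Qed.

Lemma below_coefP w f u : below w f -> f@_u != 0 -> wlt le u w.
Proof. by move/wspanP => H; rewrite mcoeff_neq0; apply: H. Qed.

Lemma is_lead_le_below f u w : is_lead le f u -> wlt le u w -> below w f.
Proof. by move=> [_ H] uw; apply/wspanP => v /H vu; apply: le_wlt_trans vu uw. Qed.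

(** Induction on the accessibility of the tail [c], with [a] arbitrary: a step at [v] lands below
    [v], where everything is accessible, and a step elsewhere is a step of [c]. *)
Lemma coef_step_acc_lead v : (forall c, below v c -> step_acc c) ->
  forall c, below v c -> forall a, step_acc (a *: << v >> + c).
Proof.
move=> Hacc c bc; have ac := Hacc c bc; elim: ac bc => {}c _ IH bc a.
constructor=> c' [p [g [cp bg ->]]].
have cv: c@_v = 0 by apply: (below_coef le_mono bc); apply: mo_refl.
have [pv|npv] := eqVneq p v.
  subst p; apply: Hacc; rewrite mcoeffD mcoeffZ mcoeff_basis eqxx mulr1 cv addr0.
  have -> : a *: << v >> + c - a *: (<< v >> - g) = c + a *: g.
    by rewrite scalerBr opprB addrC subrKA addrC.
  by apply: belowD bc _; apply: belowZ.
have ecp: (a *: << v >> + c)@_p = c@_p.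
  by rewrite mcoeffD mcoeffZ mcoeff_basis eq_sym (negPf npv) mulr0 add0r.
rewrite ecp in cp *; rewrite -addrA.
have pv: wlt le p v by apply: below_coefP bc cp.
apply: IH; first by exists p, g.
apply: belowB bc _; apply: belowZ; apply: belowB; first exact: below_basis.
exact: belowW (wltW pv) bg.
Qed.

Lemma coef_step_acc0 : step_acc 0.
Proof. by constructor=> c' [p [g []]]; rewrite mcoeff0 eqxx. Qed.

Lemma coef_step_acc_below w c : below w c -> step_acc c.
Proof.
elim/(wlt_ind le_mono): w c => w IH c bc.
have [->|nc] := eqVneq c 0; first exact: coef_step_acc0.
have [v lv] := lead_exists le_mono nc; have [vc _] := lv.
have vw: wlt le v w by move/wspanP: bc; apply.
rewrite -(subrK (c@_v *: << v >>) c) addrC; apply: coef_step_acc_lead.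
  by move=> c' bc'; apply: IH vw _ bc'.
exact: is_lead_below.
Qed.

Lemma coef_step_acc c : step_acc c.
Proof.
have [->|nc] := eqVneq c 0; first exact: coef_step_acc0.
have [v lv] := lead_exists le_mono nc.
rewrite -(subrK (c@_v *: << v >>) c) addrC; apply: coef_step_acc_lead.
  by move=> c'; apply: coef_step_acc_below.
exact: is_lead_below.
Qed.

(** The common frame of both systems: [R p r] says that some rule at [b p] subtracts multiples of
    [r]. It is used with [D], [b] being [alsbw], [lsbw] on the Lie side, and all words with the
    words themselves as basis on the associative side. *)
Context (D : word Z -> Prop) (b : word Z -> A).
Hypothesis b_monic : forall w, D w -> monic_at le w (b w).
Context (V W : A -> Prop).
Hypothesis WP : forall t, W t <-> exists2 w, D w & t = b w.
Hypothesis VP : forall f, V f <-> lincomb W f.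
Context (R : word Z -> A -> Prop).
Hypothesis RP : forall p r, R p r -> [/\ D p, V r & monic_at le p r].
Context (Pi : A -> A -> Prop).
Hypothesis PiP : forall t f, Pi t f <-> exists p r, [/\ R p r, t = b p & f = b p - r].

Local Notation Phi := (linext b).
Local Notation step := (rw_step V W Pi).
Local Notation rewrites := (rw_star V W Pi).
Let lPhi : linear_map Phi := linext_linear b.

Lemma VPhi f : V f <-> exists2 c, wspan D c & f = Phi c.
Proof.
rewrite VP; split=> [|[c Dc ->]].
  move: f; apply: lincomb_ind.
  - by exists 0; [apply: lincomb0|rewrite (linear_map0 lPhi)].
  - move=> f g [c Dc ->] [d Dd ->]; exists (c + d); first exact: lincombD.
    by rewrite (linear_mapD lPhi).
  - move=> a f [c Dc ->]; exists (a *: c); first exact: lincombZ.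
    by rewrite (linear_mapZ lPhi).
  - move=> x /WP[w Dw ->]; exists << w >>; first exact: wspanU.
    by rewrite linextU.
apply: (lincomb_image lPhi) Dc => _ [w Dw ->].
by rewrite linextU; apply: lincomb_gen; apply/WP; exists w.
Qed.

Lemma VB f g : V f -> V g -> V (f - g).
Proof. by rewrite !VP; apply: lincombB. Qed.

Lemma VZ a f : V f -> V (a *: f).
Proof. by rewrite !VP; apply: lincombZ. Qed.

Lemma Phi_below w c : wspan (fun u => D u /\ wlt le u w) c -> below w (Phi c).
Proof.
apply: (lincomb_image lPhi) => _ [u [Du uw] ->]; rewrite linextU.
apply: wspanW (monic_at_le le_mono (b_monic Du)) => v vu.
exact: le_wlt_trans vu uw.
Qed.

Lemma wspanD_and P c : wspan D c -> wspan P c -> wspan (fun u => D u /\ P u) c.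
Proof. by move=> /wspanP HD /wspanP HP; apply/wspanP => u uc; split; [apply: HD|apply: HP]. Qed.

(** As each [b u] is monic at [u], only the top summand reaches [w]. Independence of the family [b]
    follows from this. *)
Lemma Phi_lead c w : wspan D c -> is_lead le c w ->
  is_lead le (Phi c) w /\ (Phi c)@_w = c@_w.
Proof.
move=> Dc lw; have [wc _] := lw; have Dw: D w by move/wspanP: Dc; apply.
have bc' := is_lead_below lw.
have Dc': wspan D (c - c@_w *: << w >>).
  by apply: lincombB Dc _; apply: lincombZ; apply: wspanU.
have := Phi_below (wspanD_and Dc' bc').
rewrite (linear_mapB lPhi) (linear_mapZ lPhi) linextU => H.
have {}H: below w (Phi c - c@_w *: << w >>).
  rewrite -(subrK (c@_w *: b w) (Phi c)) -addrA -scalerBr.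
  by apply: belowD H _; apply: belowZ; apply: b_monic.
have e: (Phi c)@_w = c@_w.
  have := below_coef le_mono H (mo_refl le_mono w).
  by rewrite mcoeffB mcoeffZ mcoeff_basis eqxx mulr1 => /eqP; rewrite subr_eq0 => /eqP.
split=> //; split; first by rewrite -mcoeff_neq0 e mcoeff_neq0.
apply/wspanP; rewrite -(subrK (c@_w *: << w >>) (Phi c)); apply: lincombD.
  by apply: wspanW H => u; apply: wltW.
by apply: lincombZ; apply: wspanU; apply: mo_refl.
Qed.

Lemma Phi_inj c d : wspan D c -> wspan D d -> Phi c = Phi d -> c = d.
Proof.
move=> Dc Dd e; apply/eqP; rewrite -subr_eq0; apply/negPn/negP => ncd.
have [w lw] := lead_exists le_mono ncd.
have [[]] := Phi_lead (lincombB Dc Dd) lw.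
by rewrite (linear_mapB lPhi) e subrr -mcoeff_neq0 mcoeff0 eqxx.
Qed.

Lemma below_Phi w c : wspan D c -> below w (Phi c) -> below w c.
Proof.
move=> Dc bPhi; have [->|nc] := eqVneq c 0; first exact: lincomb0.
have [v lv] := lead_exists le_mono nc.
have [[vPhi _] _] := Phi_lead Dc lv.
by apply: is_lead_le_below lv _; move/wspanP: bPhi; apply.
Qed.

Lemma monic_at_Phi w c : D w -> wspan D c -> monic_at le w (Phi c) -> monic_at le w c.
Proof.
move=> Dw Dc H; apply: below_Phi; first by apply: lincombB Dc _; apply: wspanU.
rewrite (linear_mapB lPhi) linextU -(subrK << w >> (Phi c)) -addrA.
by apply: belowD H _; rewrite -opprB; apply: lincombN; apply: b_monic.
Qed.

Lemma b_inj u v : D u -> D v -> b u = b v -> u = v.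
Proof.
move=> Du Dv e; apply: (is_lead_uniq le_mono (f := b u)).
  exact/(monic_at_lead le_mono)/b_monic.
by rewrite e; apply/(monic_at_lead le_mono)/b_monic.
Qed.

Lemma has_coef_Phi p c a : D p -> wspan D c -> (has_coef W (b p) a (Phi c) <-> c@_p = a).
Proof.
move=> Dp Dc; split=> [[g Wg e]|<-].
  have [d Dd def_g]: exists2 d, wspan (fun u => D u /\ u <> p) d & g = Phi d.
    move: g Wg {e}; apply: lincomb_ind.
    - by exists 0; [apply: lincomb0|rewrite (linear_map0 lPhi)].
    - move=> f g [d1 D1 ->] [d2 D2 ->]; exists (d1 + d2); first exact: lincombD.
      by rewrite (linear_mapD lPhi).
    - move=> a' f [d1 D1 ->]; exists (a' *: d1); first exact: lincombZ.
      by rewrite (linear_mapZ lPhi).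
    - move=> x [/WP[u Du ->] nx]; exists << u >>; last by rewrite linextU.
      by apply: wspanU; split=> // up; apply: nx; rewrite up.
  have Dd': wspan D d by apply: wspanW Dd => u [].
  have -> : c = a *: << p >> + d.
    apply: Phi_inj; first exact: Dc.
      by apply: lincombD Dd'; apply: lincombZ; apply: wspanU.
    by rewrite lPhi linextU e def_g.
  rewrite mcoeffD mcoeffZ mcoeff_basis eqxx mulr1 mcoeff_outdom ?addr0 //.
  by apply/negP; move/wspanP: Dd => /[apply] -[].
exists (Phi (c - c@_p *: << p >>)); last first.
  by rewrite (linear_mapB lPhi) (linear_mapZ lPhi) linextU addrC subrK.
have: wspan (fun u => D u /\ u <> p) (c - c@_p *: << p >>).
  apply/wspanP => u; rewrite -mcoeff_neq0 mcoeffB mcoeffZ mcoeff_basis => nu.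
  have nup: u != p by apply: contraNneq nu => ->; rewrite eqxx mulr1 subrr.
  split; last exact/eqP.
  move/wspanP: Dc; apply; move: nu.
  by rewrite [p == u]eq_sym (negPf nup) mulr0 subr0 mcoeff_neq0.
apply: (lincomb_image lPhi) => _ [u [Du up] ->]; rewrite linextU.
apply: lincomb_gen; split; first by apply/WP; exists u.
by move/(b_inj Du Dp).
Qed.

(** In $f - a\,b_p + a(b_p - r)$ the terms in $b_p$ cancel, which leaves $f - a r$. *)
Lemma stepP f g : step f g <->
  exists c p r, [/\ wspan D c, f = Phi c, R p r, c@_p != 0 & g = f - c@_p *: r].
Proof.
split=> [[Vf [t [v [a [Wt /PiP[p [r [Rr -> ->]]] na hc ->]]]]]|].
  have [Dp Vr rp] := RP Rr; have [c Dc def_f] := (VPhi f).1 Vf.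
  have ca: c@_p = a by apply/has_coef_Phi; rewrite -?def_f.
  exists c, p, r; split=> //; first by rewrite ca.
  by rewrite ca scalerBr addrA subrK.
move=> [c [p [r [Dc -> Rr ncp ->]]]]; have [Dp Vr rp] := RP Rr.
split; first by apply/VPhi; exists c.
exists (b p), (b p - r), c@_p; split=> //.
- by apply/WP; exists p.
- by apply/PiP; exists p, r.
- exact/has_coef_Phi.
- by rewrite scalerBr addrA subrK.
Qed.

Lemma stepV f g : step f g -> V f /\ V g.
Proof.
move=> /stepP[c [p [r [Dc def_f Rr _ ->]]]]; have [_ Vr _] := RP Rr.
have Vf: V f by apply/VPhi; exists c.
by split=> //; apply: VB Vf (VZ _ Vr).
Qed.

Lemma rewritesV f g : rewrites f g -> V f -> V g.
Proof. by elim=> [x y /stepV[]|x|x y z _ IH1 _ IH2 /IH1/IH2]. Qed.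

Lemma step_wf f : V f -> Acc (fun g f => step f g) f.
Proof.
move=> /VPhi[c Dc ->]; elim: (coef_step_acc c) Dc => {}c _ IH Dc.
constructor=> g /stepP[c' [p [r [Dc' e Rr ncp ->]]]].
move/(Phi_inj Dc Dc'): e => ecc; rewrite -ecc in Dc' ncp *.
have [Dp /VPhi[d Dd def_r] rp] := RP Rr.
rewrite def_r -(linear_mapZ lPhi) -(linear_mapB lPhi); apply: IH; last first.
  by apply: lincombB Dc _; apply: lincombZ.
exists p, (<< p >> - d); split; [exact: ncp| |by rewrite subKr].
rewrite -opprB; apply: lincombN; apply: (monic_at_Phi Dp Dd).
by rewrite -def_r.
Qed.

Lemma triangular_terminating : terminating V W Pi.
Proof.
move=> [F HF]; have V0: V (F 0%N) by case: (HF 0%N).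
suff H f : Acc (fun g f => step f g) f -> forall n, F n <> f.
  exact: H (step_wf V0) 0%N erefl.
elim=> {}f _ IH n def_f; apply: (IH (F n.+1) _ n.+1 erefl).
by rewrite -def_f.
Qed.

Definition normal f := forall g, ~ step f g.

Lemma normal_form f : V f -> exists2 n, rewrites f n & normal n.
Proof.
move=> /step_wf; elim=> {}f _ IH.
have [[g fg]|nf] := pselect (exists g, step f g); last first.
  by exists f; [apply: rt_refl|move=> g fg; apply: nf; exists g].
have [n gn nn] := IH g fg; exists n => //.
by apply: rt_trans gn; apply: rt_step.
Qed.

Lemma normal_coef c p r : wspan D c -> normal (Phi c) -> R p r -> c@_p = 0.
Proof.
move=> Dc nc Rr; apply/eqP/negPn/negP => ncp.
by apply: (nc (Phi c - c@_p *: r)); apply/stepP; exists c, p, r.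
Qed.

Lemma normal_rewrites n g : normal n -> rewrites n g -> g = n.
Proof.
move=> nn ng; elim: ng nn => // [x y xy /(_ y)//|x y z _ IH1 _ IH2 nx].
by have e := IH1 nx; rewrite e in IH2; apply: IH2.
Qed.

(** A linear span is enough, because contexts are already part of the rules. *)
Definition ideal : A -> Prop := lincomb (fun x => exists p, R p x).

Lemma rewrites_ideal f g : rewrites f g -> ideal (f - g).
Proof.
elim=> [x y /stepP[c [p [r [_ _ Rr _ ->]]]]|x|x y z _ IH1 _ IH2].
- by rewrite opprB addrC subrK; apply: lincombZ; apply: lincomb_gen; exists p.
- by rewrite subrr; apply: lincomb0.
- by rewrite -(subrKA y); apply: lincombD.
Qed.

(** A normal form has coordinate 0 at every rule word, hence so has the difference of two of them,
    and its leading coordinate cannot sit at a rule word. *)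
Lemma triangular_confluent :
  (forall h, ideal h -> h != 0 -> exists p r, R p r /\ is_lead le h p) ->
  confluent V W Pi.
Proof.
move=> Hlead f g1 g2 Vf fg1 fg2.
have [n1 gn1 nn1] := normal_form (rewritesV fg1 Vf).
have [n2 gn2 nn2] := normal_form (rewritesV fg2 Vf).
suff e : n1 = n2 by exists n1; split=> //; rewrite e.
have fn1 : rewrites f n1 by apply: rt_trans gn1.
have fn2 : rewrites f n2 by apply: rt_trans gn2.
have In : ideal (n1 - n2).
  have := lincombB (rewrites_ideal fn2) (rewrites_ideal fn1).
  by rewrite opprB addrC subrKA.
have /VPhi[c1 D1 e1] := rewritesV fn1 Vf; have /VPhi[c2 D2 e2] := rewritesV fn2 Vf.
apply/eqP; rewrite -subr_eq0; apply/negPn/negP => nn.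
have [p [r [Rr lp]]] := Hlead _ In nn.
move: nn lp; rewrite e1 e2 -(linear_mapB lPhi) => nn lp.
have Dc : wspan D (c1 - c2) by apply: lincombB.
have nc : c1 - c2 != 0.
  by apply: contraNneq nn => ->; rewrite (linear_map0 lPhi).
have [w lw] := lead_exists le_mono nc.
have [lw' _] := Phi_lead Dc lw.
have [] := lw; rewrite (is_lead_uniq le_mono lw' lp) -mcoeff_neq0 mcoeffB.
rewrite (normal_coef D1 _ Rr) -?e1 // (normal_coef D2 _ Rr) -?e2 //.
by rewrite subrr eqxx.
Qed.

(** Clear the coordinate at [p] in both elements: [r] has coordinate 1 there, so the added multiple
    of [r] disappears and the results coincide. *)
Lemma rule_joinable f p r a : V f -> R p r ->
  exists h, rewrites f h /\ rewrites (f + a *: r) h.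
Proof.
move=> /VPhi[c Dc ->] Rr; have [Dp /VPhi[d Dd def_r] rp] := RP Rr.
have d1: d@_p = 1.
  by apply: (monic_at_coef le_mono); apply: (monic_at_Phi Dp Dd); rewrite -def_r.
(* When the coordinate is already 0 there is no step to make, and reflexivity covers the case. *)
have one e : wspan D e -> rewrites (Phi e) (Phi e - e@_p *: r).
  move=> De; have [e0|ne] := eqVneq (e@_p) 0.
    by rewrite e0 scale0r subr0; apply: rt_refl.
  apply: rt_step; apply/stepP; exists e, p, r.
  split; [exact: De|exact: erefl|exact: Rr|exact: ne|exact: erefl].
exists (Phi c - c@_p *: r); split; first exact: one.
have := one (c + a *: d); rewrite (linear_mapD lPhi) (linear_mapZ lPhi) -def_r.
rewrite mcoeffD mcoeffZ d1 mulr1 scalerDl opprD addrA addrAC addrK; apply.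
by apply: lincombD Dc _; apply: lincombZ.
Qed.

(** Induction on the number of summands: the shorter sum rewrites to 0 and shares a reduct with the
    longer one by [rule_joinable]; confluence joins this reduct with 0, which is normal. *)
Lemma ideal_rewrites0 h : confluent V W Pi -> ideal h -> rewrites h 0.
Proof.
move=> conf; have V0 : V 0 by apply/VP; apply: lincomb0.
have n0 : normal 0.
  move=> g /stepP[c [p [r [Dc e _]]]].
  have -> : c = 0.
    by apply: Phi_inj; [exact: Dc|apply: lincomb0|rewrite -e (linear_map0 lPhi)].
  by rewrite mcoeff0 eqxx.
move=> [l [Hl ->]]; elim: l Hl => [|[a r] l IH] Hl; first by rewrite big_nil; apply: rt_refl.
rewrite big_cons /= addrC; have [p Rr] := Hl _ (mem_head _ _).
have {}IH := IH (fun x xl => Hl x (mem_behead (s := (a, r) :: l) xl)).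
have Vs : V (\sum_(x <- l) x.1 *: x.2).
  apply/VP; rewrite big_seq; apply: big_ind; [exact: lincomb0|exact: lincombD|].
  move=> x xl; apply: lincombZ; apply/VP.
  by have [q /RP[]] := Hl x (mem_behead (s := (a, r) :: l) xl).
have [g [sg sag]] := rule_joinable a Vs Rr.
have [h' [gh' h'0]] := conf _ _ _ Vs sg IH.
rewrite (normal_rewrites n0 h'0) in gh'.
exact: rt_trans sag gh'.
Qed.

(** A step acts at a nonzero coordinate, hence below [w], and what it subtracts stays below [w].
    This supplies the strict bound in the definition of triviality. *)
Lemma rewrites_below w f g : rewrites f g -> below w f ->
  below w g /\ lincomb (fun x => exists2 p, R p x & wlt le p w) (f - g).
Proof.
elim=> [x y /stepP[c [p [r [Dc -> Rr ncp ->]]]] bx|x bx|x y z _ IH1 _ IH2 bx].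
- have [_ _ rp] := RP Rr.
  have pw: wlt le p w by apply: below_coefP ncp; apply: below_Phi.
  split; last by rewrite subKr; apply: lincombZ; apply: lincomb_gen; exists p.
  apply: belowB bx _; apply: belowZ.
  by apply: wspanW (monic_at_le le_mono rp) => v vp; apply: le_wlt_trans vp pw.
- by rewrite subrr; split=> //; apply: lincomb0.
- have [by_ lxy] := IH1 bx; have [bz lyz] := IH2 by_; split; first exact: bz.
  by rewrite -(subrKA y); apply: lincombD.
Qed.

Lemma triangular_convergent :
  (forall h, ideal h -> h != 0 -> exists p r, R p r /\ is_lead le h p) ->
  convergent V W Pi.
Proof.
by move=> H; split; [exact: triangular_terminating|exact: triangular_confluent].
Qed.

Lemma confluent_ideal_below w h : confluent V W Pi -> ideal h -> below w h ->
  lincomb (fun x => exists2 p, R p x & wlt le p w) h.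
Proof.
move=> conf /(ideal_rewrites0 conf) h0 /(rewrites_below h0)[_].
by rewrite subr0.
Qed.

End TriangularRewriting.

(** * The composition-diamond lemma in the semigroup algebra *)

Lemma subr_swap (V : zmodType) (a b c : V) : a - b = (c - b) - (c - a).
Proof. by rewrite opprB [RHS]addrC subrKA. Qed.

Lemma subr_scaleD (k : fieldType) (E : lmodType k) (f g r : E) a b :
  f + g - (a + b) *: r = (f - a *: r) + (g - b *: r).
Proof. by rewrite scalerDl opprD addrACA. Qed.

Section CompositionDiamond.
Context (k : fieldType) (Z : choiceType) (le : rel (word Z)).
Hypothesis le_mono : monomial_order le.
Local Notation A := {malg k[word Z]}.
Context (S : A -> Prop).
Hypothesis S_monic : forall s, S s -> is_monic le s.
Implicit Types (f g h s : A) (u v w : word Z) (q : word (option Z)).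

Lemma S_monic_at s v : S s -> is_lead le s v -> monic_at le v s.
Proof. by move=> /S_monic Ms; apply: (monic_lead le_mono). Qed.

Definition ass_rule p r : Prop :=
  exists s q v, [/\ S s, is_lead le s v, starred q, p = plug q v & r = aplug q s].

Definition ass_span (P : word Z -> Prop) : A -> Prop :=
  lincomb (fun x => exists2 p, ass_rule p x & P p).

Lemma trivial_assP w h : trivial_ass le S w h <-> ass_span (fun p => wlt le p w) h.
Proof.
split; apply: lincombW => x.
  by move=> [s [q [v [Ss lv sq [vw ->]]]]]; exists (plug q v) => //; exists s, q, v.
by move=> [_ [s [q [v [Ss lv sq -> ->]]]] vw]; exists s, q, v.
Qed.

Lemma ass_span_plug q w f : starred q ->
  ass_span (fun p => wlt le p w) f -> ass_span (fun p => wlt le p (plug q w)) (aplug q f).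
Proof.
move=> sq; apply: (lincomb_image (aplug_linear q)) => _ [_ [s [r [v [Ss lv sr -> ->]]]] vw].
rewrite -aplug_comp; apply: lincomb_gen; exists (plug q (plug r v)); last exact: wlt_plug.
exists s, (plug_star q r), v; split=> //; first exact: starred_plug_star.
by rewrite plug_comp.
Qed.

(** Both sides are the bilinear extension of filling the two holes, so agreement on pairs of words
    suffices. *)
Lemma two_hole_linear (G1 G2 : word Z -> word (option Z)) f g :
  (forall u v, plug (G1 v) u = plug (G2 u) v) ->
  linext (fun v => aplug (G1 v) f) g = linext (fun u => aplug (G2 u) g) f.
Proof.
move=> G12.
have l1 g' : linear_map (fun f => linext (fun v => aplug (G1 v) f) g').
  move=> a f1 f2; rewrite /linext scaler_sumr -big_split.
  by apply: eq_bigr => v _ /=; rewrite (aplug_linear _) scalerDr !scalerA mulrC.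
have lF := linext_linear (fun u => aplug (G2 u) g).
apply: (malg_ext (l1 g) lF) => u /=; rewrite [RHS]linextU.
have lG := linext_linear (fun v => aplug (G1 v) (<< u >> : A)).
by apply: (malg_ext lG (aplug_linear (G2 u))) => v; rewrite [LHS]linextU !aplugU G12.
Qed.

Lemma ass_span_linext (G : word Z -> word (option Z)) s v g w (P : word Z -> Prop) :
  S s -> is_lead le s v -> (forall u, starred (G u)) ->
  (forall u, P u -> wlt le (plug (G u) v) w) ->
  wspan P g -> ass_span (fun p => wlt le p w) (linext (fun u => aplug (G u) s) g).
Proof.
move=> Ss lv sG H; apply: (lincomb_image (linext_linear _)) => _ [u Pu ->].
rewrite linextU; apply: lincomb_gen; exists (plug (G u) v); last exact: H.
by exists s, (G u), v.
Qed.

Hypothesis S_GSB : GSB_ass le S.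

(** Nested and overlapping occurrences are compositions placed in a context. For disjoint ones the
    difference is routed through the two-hole context with [s1] and [s2] filled in. *)
Lemma critical_pair s1 v1 q1 s2 v2 q2 :
  S s1 -> is_lead le s1 v1 -> starred q1 -> S s2 -> is_lead le s2 v2 -> starred q2 ->
  plug q1 v1 = plug q2 v2 ->
  ass_span (fun p => wlt le p (plug q1 v1)) (aplug q1 s1 - aplug q2 s2).
Proof.
suff H s1' v1' q1' s2' v2' q2' :
    S s1' -> is_lead le s1' v1' -> starred q1' -> S s2' -> is_lead le s2' v2' -> starred q2' ->
    occurrences q1' v1' q2' v2' ->
    ass_span (fun p => wlt le p (plug q1' v1')) (aplug q1' s1' - aplug q2' s2').
  move=> S1 l1 sq1 S2 l2 sq2 e.
  have [occ|occ] := occurrencesP sq1 sq2 e; first exact: H S1 l1 sq1 S2 l2 sq2 occ.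
  by rewrite -opprB e; apply: lincombN; apply: H S2 l2 sq2 S1 l1 sq1 occ.
move: s1' v1' q1' s2' v2' q2' => {s1 v1 q1 s2 v2 q2} s1 v1 q1 s2 v2 q2.
move=> S1 l1 sq1 S2 l2 sq2; case.
- move=> r sr def_q2 def_v1; rewrite def_q2 aplug_comp -(linear_mapB (aplug_linear q1)).
  apply: ass_span_plug sq1 _; apply/trivial_assP.
  by have [_] := S_GSB v1 S1 S2 l1 l2; apply.
- move=> Q x y sQ def_q1 def_q2 e lt_y.
  have -> : plug q1 v1 = plug Q (wcat v1 y).
    by rewrite def_q1 plug_comp plug_wcat plug_wlift.
  rewrite def_q1 def_q2 !aplug_comp -(linear_mapB (aplug_linear Q)).
  apply: ass_span_plug sQ _; rewrite -amul_aplug_r -amul_aplug_l !aplug_star.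
  apply/trivial_assP; have [H _] := S_GSB (wcat v1 y) S1 S2 l1 l2; apply: H.
  have b_cat u v : breadth (wcat u v) = (breadth u + breadth v)%N.
    by rewrite /breadth letters_wcat size_cat.
  have b_gt0 u : (0 < breadth u)%N by apply: size_letters_gt0.
  split; [exact: erefl|exact: e|].
  rewrite gtn_max {2}e !b_cat ltn_add2l lt_y andbT.
  by rewrite -{1}[breadth v1]addn0 ltn_add2l -{1}[breadth v2]add0n ltn_add2r !b_gt0.
- move=> G1 G2 sG1 sG2 def_q1 def_q2 G12.
  have G12' u v : plug (G1 v) u = plug (G2 u) v by apply: G12.
  pose F1 v := aplug (G1 v) s1; pose F2 u := aplug (G2 u) s2.
  have -> : aplug q1 s1 = linext F1 << v2 >> by rewrite [RHS]linextU /F1 -def_q1.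
  have -> : aplug q2 s2 = linext F2 << v1 >> by rewrite [RHS]linextU /F2 -def_q2.
  have eT : linext F1 s2 = linext F2 s1 by apply: two_hole_linear.
  have B1 : linext F1 (s2 - << v2 >>) = linext F2 s1 - linext F1 << v2 >>.
    exact: etrans (linear_mapB (linext_linear F1) _ _) (congr1 (fun x => x - _) eT).
  have B2 := linear_mapB (linext_linear F2) s1 << v1 >>.
  (* $F_1(v_2) - F_2(v_1) = F_2(s_1 - v_1) - F_1(s_2 - v_2)$, because $F_2(s_1) = F_1(s_2)$; both
     remainders are below the leading words. *)
  have E := etrans (subr_swap _ _ (linext F2 s1)) (esym (f_equal2 (fun x y => x - y) B2 B1)).
  rewrite E.
  apply: lincombB.
    apply: (ass_span_linext S2 l2 sG2 _ (S_monic_at S1 l1)) => u uv.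
    by rewrite -G12' def_q1; apply: wlt_plug.
  apply: (ass_span_linext S1 l1 sG1 _ (S_monic_at S2 l2)) => u uv.
  by rewrite G12' def_q1 G12'; apply: wlt_plug.
Qed.

(** A finite combination has a largest rule word, which inherits [P]. This turns a strict bound into
    a weak bound at a smaller word, as the descent in [composition_diamond] requires. *)
Lemma ass_span_bound P h : ass_span P h ->
  h = 0 \/ exists2 w, P w & ass_span (fun p => le p w) h.
Proof.
have mono w w' f : le w w' -> ass_span (fun p => le p w) f -> ass_span (fun p => le p w') f.
  by move=> ww'; apply: lincombW => x [p rp pw]; exists p => //; apply: mo_trans ww'.
move: h; apply: lincomb_ind.
- by left.
- move=> f g [->|[w Pw Hw]] [->|[w' Pw' Hw']]; rewrite ?addr0 ?add0r; [by left|by right; exists w'|by right; exists w|].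
  right; have /orP[ww'|w'w] := mo_total le_mono w w'.
    by exists w' => //; apply: lincombD Hw'; apply: mono Hw.
  by exists w => //; apply: (lincombD Hw); apply: mono Hw'.
- by move=> a f [->|[w Pw Hw]]; [left; rewrite scaler0|right; exists w => //; apply: lincombZ].
- by move=> x [p rp Pp]; right; exists p => //; apply: lincomb_gen; exists p => //; apply: mo_refl.
Qed.

(** All rules at the word [w] agree up to lower ones by [critical_pair], so the top part of a
    combination collapses to a multiple of one of them. *)
Lemma ass_span_top w h : ass_span (fun p => le p w) h ->
  ass_span (fun p => wlt le p w) h \/
  exists a r, ass_rule w r /\ ass_span (fun p => wlt le p w) (h - a *: r).
Proof.
have [[r0 rw]|no] := pselect (exists r, ass_rule w r); last first.
  move=> H; left; move: H; apply: lincombW => x [p rp pw]; exists p => //.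
  rewrite (le_eqVwlt le_mono) in pw; case/orP: pw => // /eqP e.
  by case: no; exists x; rewrite -e.
move=> H; right; suff [a Ha] : exists a, ass_span (fun p => wlt le p w) (h - a *: r0).
  by exists a, r0.
move: h H; apply: lincomb_ind.
- by exists 0; rewrite scale0r subrr; apply: lincomb0.
- move=> f g [a Ha] [a' Ha']; exists (a + a').
  by rewrite subr_scaleD; exact: lincombD Ha Ha'.
- move=> c f [a Ha]; exists (c * a).
  rewrite -scalerA -scalerBr; exact: lincombZ.
move=> x [p rp]; rewrite (le_eqVwlt le_mono) => /orP[/eqP e|pw]; last first.
  by exists 0; rewrite scale0r subr0; apply: lincomb_gen; exists p.
subst p; exists 1; rewrite scale1r.
case: rp rw => s [q [v [Ss lv sq -> ->]]] [s' [q' [v' [Ss' lv' sq' e ->]]]].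
exact: (critical_pair Ss lv sq Ss' lv' sq' e).
Qed.

Lemma ass_rule_monic p r : ass_rule p r -> monic_at le p r.
Proof.
by move=> [s [q [v [Ss lv sq -> ->]]]]; apply: (monic_at_aplug le_mono sq); apply: S_monic_at.
Qed.

(** Induction on a bound for the rule words of a representation: if the top coefficient vanishes, a
    lower representation exists; otherwise nothing cancels the top and [w] leads [h]. *)
Lemma composition_diamond P h : ass_span P h -> h != 0 ->
  exists p r, ass_rule p r /\ is_lead le h p.
Proof.
move=> /ass_span_bound[->|[w _]]; first by rewrite eqxx.
elim/(wlt_ind le_mono): w h => w IH h Hh nh.
have low g : ass_span (fun p => wlt le p w) g -> g != 0 ->
    exists p r, ass_rule p r /\ is_lead le g p.
  by move=> /ass_span_bound[->|[v vw Hv]] ng; [rewrite eqxx in ng|apply: IH Hv ng].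
have [Hw|[a [r [rw Hw]]]] := ass_span_top Hh; first exact: low.
have [a0|na] := eqVneq a 0.
  by apply: low => //; move: Hw; rewrite a0 scale0r subr0.
exists w, r; split=> //.
have bw: below le w (h - a *: r).
  apply: lincomb_bind Hw => x [p rp pw].
  by apply: wspanW (monic_at_le le_mono (ass_rule_monic rp)) => v vp; apply: le_wlt_trans vp pw.
have bh : below le w (h - a *: << w >>).
  rewrite -(subrK (a *: r) h) -addrA -scalerBr.
  by apply: belowD bw _; apply: belowZ; apply: ass_rule_monic.
split.
  rewrite -mcoeff_neq0; have := below_coef le_mono bh (mo_refl le_mono w).
  by rewrite mcoeffB mcoeffZ mcoeff_basis eqxx mulr1 => /eqP; rewrite subr_eq0 => /eqP->.
apply/wspanP; rewrite -(subrK (a *: << w >>) h); apply: lincombD.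
  by apply: wspanW bh => u; apply: wltW.
by apply: lincombZ; apply: wspanU; apply: mo_refl.
Qed.

End CompositionDiamond.

(** * Passage between the Lie and the associative side *)

Section Equivalence.
Context (k : fieldType) (Z : choiceType) (le : rel (word Z)).
Hypothesis le_mono : monomial_order le.
Hypothesis le_inv : invariant_order le.
Local Notation A := {malg k[word Z]}.
Context (S : A -> Prop).
Hypothesis S_OLie : forall s, S s -> OLie s.
Hypothesis S_monic : forall s, S s -> is_monic le s.
Implicit Types (f g h s : A) (u v w : word Z) (q : word (option Z)).

(** Expand [f] in Lyndon-Shirshov bracketings; by [Phi_lead] its leading word is that of one of the
    basis elements. *)
Lemma OLie_lead_alsbw f w : OLie f -> is_lead le f w -> alsbw le w.
Proof.
move=> /(OLie_NLSBW le_mono) Nf lw.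
have WP (t : A) : NLSBW le t <-> exists2 w, alsbw le w & t = lsbw k le w by [].
have VP f' : lincomb (NLSBW le) f' <-> lincomb (NLSBW le) f' by [].
have [c Dc def_f] := (VPhi WP VP f).1 Nf.
have nc : c != 0.
  apply/eqP => c0; have [] := lw; rewrite def_f c0 (linear_map0 (linext_linear _)).
  by rewrite -mcoeff_neq0 mcoeff0 eqxx.
have [u lu] := lead_exists le_mono nc.
have [lu' _] := Phi_lead le_mono (lsbw_monic k le_mono le_inv) Dc lu.
rewrite -def_f in lu'; rewrite -(is_lead_uniq le_mono lu' lw).
by have [uc _] := lu; move/wspanP: Dc; apply.
Qed.

Lemma S_alsbw s v : S s -> is_lead le s v -> alsbw le v.
Proof. by move=> /S_OLie; apply: OLie_lead_alsbw. Qed.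

Definition lie_rule p r : Prop :=
  exists s q v, [/\ S s, is_lead le s v, starred q, alsbw le (plug q v) &
    p = plug q v /\ r = snw le q s v].

Lemma lie_rule_sound p r : lie_rule p r -> [/\ alsbw le p, OLie r & monic_at le p r].
Proof.
move=> [s [q [v [Ss lv sq aq [-> ->]]]]]; split=> //; first exact/snw_OLie/S_OLie.
exact: (snw_monic le_mono le_inv sq (S_alsbw Ss lv) aq (S_monic_at le_mono S_monic Ss lv)).
Qed.

Lemma snw_ass_span s q v : S s -> is_lead le s v -> starred q -> alsbw le (plug q v) ->
  ass_span le S (fun p => wlt le p (plug q v)) (snw le q s v - aplug q s).
Proof.
move=> Ss lv sq aq.
have := snw_aplug le_mono le_inv s sq (S_alsbw Ss lv) aq.
apply: lincombW => _ [r [sr rq ->]]; exists (plug r v) => //.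
by exists s, r, v.
Qed.

Lemma snw_ass_span_le s q v w : S s -> is_lead le s v -> starred q -> alsbw le (plug q v) ->
  wlt le (plug q v) w -> ass_span le S (fun p => wlt le p w) (snw le q s v).
Proof.
move=> Ss lv sq aq qw; rewrite -(subrK (aplug q s) (snw le q s v)); apply: lincombD.
  have := snw_ass_span Ss lv sq aq; apply: lincombW => x [p rp pq].
  by exists p => //; apply: wlt_trans pq qw.
by apply: lincomb_gen; exists (plug q v) => //; exists s, q, v.
Qed.

Lemma trivial_Lie_ass w h : trivial_Lie le S w h -> ass_span le S (fun p => wlt le p w) h.
Proof.
apply: lincomb_bind => _ [s [q [v [Ss lv sq aq [qw ->]]]]].
exact: snw_ass_span_le.
Qed.

(** The breadth bounds give a nonempty common part [m], along which [lyndon_overlap] glues. This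
    makes the special normal words in the composition meaningful. *)
Lemma intersection_alsbw fb gb w u v : alsbw le fb -> alsbw le gb ->
  intersection_at fb gb w u v -> alsbw le w.
Proof.
move=> af ag [ef eg /andP[_ lt_w]].
have e : letters fb ++ letters u = letters v ++ letters gb.
  by rewrite -!letters_wcat -ef -eg.
have lt_v : (size (letters v) < size (letters fb))%N.
  by move: lt_w; rewrite /breadth eg letters_wcat size_cat ltn_add2r.
have [[d def_v]|[m [nm def_f def_g]]] := cat_eq_cat e.
  by move: lt_v; rewrite def_v size_cat ltnNge leq_addr.
have ew : letters w = letters v ++ m ++ letters u by rewrite eg letters_wcat def_g.
apply/alsbwP; split.
  apply/(alswP le_mono); rewrite ew; apply: (lyndon_overlap (rlt_trans le_mono)).
  - by rewrite -def_f; apply: alsbw_lyndon.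
  - by rewrite -def_g; apply: alsbw_lyndon.
  - by case: (letters v) (@letters_nil _ v) => [/(_ erefl)|].
  - exact: nm.
move=> w'; rewrite ew catA -def_f mem_cat => /orP[w'f|w'u].
  by have /alsbwP[_] := af; apply.
by have /alsbwP[_] := ag; apply; rewrite def_g mem_cat w'u orbT.
Qed.

Lemma aplug_star_r f u : amul f << u >> = aplug (wcat star (wlift u)) f.
Proof. by rewrite -amul_aplug_r aplug_star. Qed.

Lemma aplug_star_l f u : amul << u >> f = aplug (wcat (wlift u) star) f.
Proof. by rewrite -amul_aplug_l aplug_star. Qed.

Lemma plug_star_r u v : plug (wcat star (wlift u)) v = wcat v u.
Proof. by rewrite plug_wcat plug_wlift. Qed.

Lemma plug_star_l u v : plug (wcat (wlift u) star) v = wcat u v.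
Proof. by rewrite plug_wcat plug_wlift. Qed.

(** Lets [f] in an including composition count as a special normal word: a bracketing that erases to
    the hole can only be the hole. *)
Lemma snw_star s v : alsbw le v -> snw le star s v = s.
Proof.
move=> av; have [e _] := specialP le_mono (starred_star Z) av av.
rewrite /snw; case: (special le star v) e => [[z|]|t|a b] //=.
by move/wcat_Last.
Qed.

Lemma GSB_Lie_ass : GSB_Lie le S -> GSB_ass le S.
Proof.
move=> H f g fb gb w Sf Sg lf lg; have [Hint Hinc] := H f g fb gb w Sf Sg lf lg.
have af := S_alsbw Sf lf; have ag := S_alsbw Sg lg.
(* Each associative product is exchanged for its special normal word; both corrections have smaller
   words by [snw_ass_span]. *)
have sub (x y x' y' : A) : x - y = (x' - y') - (x' - x) + (y' - y).
  by rewrite opprB [x' - y' + _]addrC subrKA subrKA.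
split=> [u v int|q inc]; apply/trivial_assP.
  have aw := intersection_alsbw af ag int; have [ef eg _] := int.
  rewrite aplug_star_r aplug_star_l.
  rewrite (sub _ _ (snw le (wcat star (wlift u)) f fb) (snw le (wcat (wlift v) star) g gb)).
  apply: lincombD; [apply: lincombB; first exact: trivial_Lie_ass (Hint u v int)|].
    have := @snw_ass_span f (wcat star (wlift u)) fb Sf lf (starred_wcatl u (starred_star Z)).
    by rewrite plug_star_r -ef; apply.
  have := @snw_ass_span g (wcat (wlift v) star) gb Sg lg (starred_wcatr v (starred_star Z)).
  by rewrite plug_star_l -eg; apply.
have [sq ewf ewg] := inc.
rewrite -(subrKA (snw le q g gb)); apply: lincombD; first exact: trivial_Lie_ass (Hinc q inc).
by rewrite ewg; apply: snw_ass_span => //; rewrite -ewg ewf.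
Qed.

Let Lie_WP (t : A) : NLSBW le t <-> exists2 w, alsbw le w & t = lsbw k le w.
Proof. by []. Qed.

Let Lie_PiP (t f : A) : Pi_Lie le S t f <->
  exists p r, [/\ lie_rule p r, t = lsbw k le p & f = lsbw k le p - r].
Proof.
split.
  move=> [s [q [v [Ss lv sq aq [-> ->]]]]]; exists (plug q v), (snw le q s v).
  by split; [exists s, q, v|exact: erefl|exact: erefl].
move=> [_ [_ [[s [q [v [Ss lv sq aq [-> ->]]]]] -> ->]]].
by exists s, q, v.
Qed.

Let ass_b_monic w : True -> monic_at le w (<< w >> : A).
Proof. by move=> _; rewrite /monic_at subrr; apply: lincomb0. Qed.

Let ass_WP (t : A) : (exists w, t = << w >>) <-> exists2 w, True & t = << w >>.
Proof. by split=> [[w ->]|[w _ ->]]; exists w. Qed.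

Let ass_VP f : True <-> lincomb (fun t : A => exists w, t = << w >>) f.
Proof.
split=> // _; have : wspan (fun=> True) f by apply/wspanP.
by apply: lincombW => _ [u _ ->]; exists u.
Qed.

Let ass_RP p r : ass_rule le S p r -> [/\ True, True & monic_at le p r].
Proof. by move=> Rr; split=> //; apply: (ass_rule_monic le_mono S_monic Rr). Qed.

Let ass_PiP (t f : A) : Pi_ass le S t f <->
  exists p r, [/\ ass_rule le S p r, t = << p >> & f = << p >> - r].
Proof.
split.
  move=> [s [q [v [Ss lv sq [-> ->]]]]]; exists (plug q v), (aplug q s).
  split; [by exists s, q, v|exact: erefl|].
  by rewrite (linear_mapB (aplug_linear q)) aplugU.
move=> [_ [_ [[s [q [v [Ss lv sq -> ->]]]] -> ->]]].
exists s, q, v; split=> //; split; first exact: erefl.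
by rewrite (linear_mapB (aplug_linear q)) aplugU.
Qed.

Lemma convergent_Lie_GSB : convergent_Lie le S -> GSB_Lie le S.
Proof.
move=> [_ conf] f g fb gb w Sf Sg lf lg.
have af := S_alsbw Sf lf; have ag := S_alsbw Sg lg.
(* Both kinds of composition are differences of two rule elements at the same word [w]; for an
   inclusion the first context is the bare hole. *)
have key q q' : starred q -> starred q' -> alsbw le w -> w = plug q fb -> w = plug q' gb ->
    trivial_Lie le S w (snw le q f fb - snw le q' g gb).
  move=> sq sq' aw ef eg.
  have r1 : lie_rule w (snw le q f fb) by exists f, q, fb; rewrite -ef.
  have r2 : lie_rule w (snw le q' g gb) by exists g, q', gb; rewrite -eg.
  have [_ _ m1] := lie_rule_sound r1; have [_ _ m2] := lie_rule_sound r2.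
  have id : ideal lie_rule (snw le q f fb - snw le q' g gb).
    by apply: lincombB; apply: lincomb_gen; exists w.
  have bl : below le w (snw le q f fb - snw le q' g gb).
    rewrite -(subrKA << w >>) -[X in _ + X]opprB; exact: lincombB m1 m2.
  have := confluent_ideal_below le_mono (lsbw_monic k le_mono le_inv)
    Lie_WP (OLie_NLSBW le_mono) lie_rule_sound Lie_PiP conf id bl.
  apply: lincombW => x [_ [s [r [v [Ss lv sr ar [-> ->]]]]] pw].
  by exists s, r, v.
split=> [u v int|q inc].
  have aw := intersection_alsbw af ag int; have [ef eg _] := int.
  by apply: key; rewrite ?plug_star_r ?plug_star_l // ?starred_wcatl ?starred_wcatr.
have [sq ef eg] := inc; rewrite -[f in f - _](snw_star f af).
by apply: key => //; rewrite ef.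
Qed.

Lemma convergent_ass_GSB : convergent_ass le S -> GSB_ass le S.
Proof.
move=> [_ conf] f g fb gb w Sf Sg lf lg.
have key q q' : starred q -> starred q' -> w = plug q fb -> w = plug q' gb ->
    trivial_ass le S w (aplug q f - aplug q' g).
  move=> sq sq' ef eg.
  have r1 : ass_rule le S w (aplug q f) by exists f, q, fb.
  have r2 : ass_rule le S w (aplug q' g) by exists g, q', gb.
  have m1 := ass_rule_monic le_mono S_monic r1; have m2 := ass_rule_monic le_mono S_monic r2.
  have id : ideal (ass_rule le S) (aplug q f - aplug q' g).
    by apply: lincombB; apply: lincomb_gen; exists w.
  have bl : below le w (aplug q f - aplug q' g).
    rewrite -(subrKA << w >>) -[X in _ + X]opprB; exact: lincombB m1 m2.
  apply/trivial_assP.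
  exact: (confluent_ideal_below (D := fun=> True) (b := fun w => << w >>) (V := fun=> True)
    le_mono ass_b_monic ass_WP ass_VP ass_RP ass_PiP conf id bl).
split=> [u v int|q inc].
  have [ef eg _] := int; rewrite aplug_star_r aplug_star_l.
  by apply: key; rewrite ?plug_star_r ?plug_star_l // ?starred_wcatl ?starred_wcatr.
by have [sq ef eg] := inc; rewrite -[f in f - _]aplug_star; apply: key.
Qed.

Lemma GSB_ass_convergent : GSB_ass le S -> convergent_ass le S.
Proof.
move=> H; apply: (triangular_convergent (D := fun=> True) (b := fun w => << w >>)
    (V := fun=> True) le_mono ass_b_monic ass_WP ass_VP ass_RP ass_PiP).
move=> h id nh; apply: (composition_diamond le_mono S_monic H (P := fun=> True)) nh.
by apply: lincombW id => x [p rp]; exists p.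
Qed.

Lemma GSB_ass_convergent_Lie : GSB_ass le S -> convergent_Lie le S.
Proof.
move=> H; apply: (triangular_convergent le_mono (lsbw_monic k le_mono le_inv)
    Lie_WP (OLie_NLSBW le_mono) lie_rule_sound Lie_PiP).
move=> h id nh.
have Oh : OLie h.
  move: id; apply: lincomb_ind; [exact: OLie_zero|exact: OLie_add|exact: OLie_scale|].
  by move=> x [p /lie_rule_sound[]].
have Ah : ass_span le S (fun=> True) h.
  apply: lincomb_bind id => _ [_ [s [q [v [Ss lv sq aq [_ ->]]]]]].
  rewrite -(subrK (aplug q s) (snw le q s v)); apply: lincombD.
    by have := snw_ass_span Ss lv sq aq; apply: lincombW => x [p rp _]; exists p.
  by apply: lincomb_gen; exists (plug q v) => //; exists s, q, v.
have [p [_ [[s [q [v [Ss lv sq -> _]]]] lh]]] := composition_diamond le_mono S_monic H Ah nh.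
exists (plug q v), (snw le q s v); split=> //.
by exists s, q, v; split=> //; apply: OLie_lead_alsbw lh.
Qed.

End Equivalence.

Theorem theorem3p29
  (k : fieldType) (Z : choiceType) (leZ : rel Z) (leZ_wo : well_order leZ)
  (leIM : rel (word Z))
  (leIM_monomial : monomial_order leIM)
  (leIM_invariant : invariant_order leIM)
  (S : {malg k[word Z]} -> Prop)
  (S_OLie : forall s, S s -> OLie s)
  (S_monic : forall s, S s -> is_monic leIM s) :
  [<-> convergent_Lie leIM S;
       GSB_Lie leIM S;
       convergent_ass leIM S;
       GSB_ass leIM S].
Proof.
(* The cycle (a), (b), (c), (d), (a); its second arrow passes through (d). *)
split; first exact: convergent_Lie_GSB.
split; first by move=> H; apply: GSB_ass_convergent => //; apply: GSB_Lie_ass.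
split; first exact: convergent_ass_GSB.
exact: GSB_ass_convergent_Lie.
Qed.
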